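(* Let $(a,b,c)$ be a primitive positive definite form of discriminant $\Delta<0$, let $p$ be a prime, and let $G$ be a genus of discriminant $\Delta p^2$ such that $\Psi_{G,p}(a,b,c):=\Psi_p(a,b,c)\cap G$ is nonempty. Let $r$ be a positive integer coprime to $\Delta p^2$ that is represented by a form of $\Psi_{G,p}(a,b,c)$. If $p$ is odd, then $$w\sum_{(A,B,C)\in\Psi_{G,p}(a,b,c)}(A,B,C,q)=w\,|\Psi_{G,p}(a,b,c)|\,(a,b,c,q^{p^2})+\sum_{i=1}^{p-1}\frac{\left(\frac{ri}{p}\right)+1}{2}\,P_{p,i}(a,b,c,q),$$ and if $p=2$, then $$w\sum_{(A,B,C)\in\Psi_{G,2}(a,b,c)}(A,B,C,q)=w\,|\Psi_{G,2}(a,b,c)|\,(a,b,c,q^{4})+P_{2^{t+1},\,r'}(a,b,c,q),$$ where $r'$ is the least nonnegative residue of $r$ modulo $2^{t+1}$, and $t=2$ if $\Delta\equiv0\pmod{16}$, while for $\Delta\not\equiv0\pmod{16}$, $t=0$ if $\Delta$ is odd and $t=1$ if $\Delta$ is even.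
   Context: A form $(a,b,c)$ denotes the $SL(2,\mathbb Z)$-equivalence class of the positive definite form $ax^2+bxy+cy^2$ ($a>0$) of discriminant $b^2-4ac<0$; it is primitive if $\gcd(a,b,c)=1$, and $\mathrm{CL}(\Delta)$ is the set of classes of primitive forms of discriminant $\Delta$. Two primitive forms of discriminant $D$ are in the same genus if they are equivalent via a matrix in $SL(2,\mathbb Q)$ whose entries have denominators coprime to $2D$ (equivalently, they have the same values of the assigned characters of $D$); the genera partition $\mathrm{CL}(D)$. The theta series $(a,b,c,q):=\sum_{(x,y)\in\mathbb Z^2}q^{ax^2+bxy+cy^2}$ depends only on the class; $(a,b,c,q^k)$ is this series with $q\mapsto q^k$. For $m\ge1$, $0\le r<m$: $P_{m,r}\sum_{n\ge0}a(n)q^n=\sum_{n\ge0}a(mn+r)q^{mn+r}$. $\left(\frac{\cdot}{p}\right)$ is the Legendre symbol for odd $p$. $w=3$ if $\Delta=-3$, $w=2$ if $\Delta=-4$, $w=1$ if $\Delta<-4$. For a prime $p$ and primitive $(a,b,c)$ of discriminant $\Delta$, $\Psi_p(a,b,c)$ is the set of distinct classes of primitive forms occurring in the list $(a,bp,cp^2)$, $(ap^2,\,p(b+2ah),\,ah^2+bh+c)$ ($0\le h<p$) of forms of discriminant $\Delta p^2$ (a subset of $\mathrm{CL}(\Delta p^2)$, depending only on the class of $(a,b,c)$). *)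

(* Defs.v *)
From HB Require Import structures.
From mathcomp Require Import all_boot all_order all_algebra.
From Stdlib Require Import Ring.
Set Implicit Arguments. Unset Strict Implicit. Unset Printing Implicit Defensive.
Import Order.TTheory GRing.Theory Num.Theory.
Local Open Scope ring_scope.

Definition bqf := (int * int * int)%type.
Definition fa (f : bqf) : int := f.1.1.
Definition fb (f : bqf) : int := f.1.2.
Definition fc (f : bqf) : int := f.2.

Definition evalf (f : bqf) (x y : int) : int :=
  fa f * x ^+ 2 + fb f * x * y + fc f * y ^+ 2.

Definition disc (f : bqf) : int := fb f ^+ 2 - 4 * fa f * fc f.

Definition primitive (f : bqf) : bool := gcdz (gcdz (fa f) (fb f)) (fc f) == 1.

Definition posdef (f : bqf) : bool := (0 < fa f) && (disc f < 0).

Definition sl2_equiv (f g : bqf) : Prop :=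
  exists al be ga de : int, al * de - be * ga = 1 /\
    forall x y : int, evalf g x y = evalf f (al * x + be * y) (ga * x + de * y).

(* Genus equivalence for discriminant D: g(v) = f(N v) with N in SL(2,Q)
   whose entries have denominators coprime to 2D.  Writing N = M / d with
   M integral and d a common denominator (coprime to 2D), this reads: *)
Definition same_genus (D : int) (f g : bqf) : Prop :=
  exists al be ga de d : int, d != 0 /\ coprimez d (2 * D) /\
    al * de - be * ga = d ^+ 2 /\
    forall x y : int,
      d ^+ 2 * evalf g x y = evalf f (al * x + be * y) (ga * x + de * y).

Definition psi_list (p : nat) (f : bqf) : seq bqf :=
  (fa f, fb f * p%:Z, fc f * p%:Z ^+ 2) ::
  [seq (fa f * p%:Z ^+ 2, p%:Z * (fb f + 2 * fa f * h%:Z),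
        fa f * h%:Z ^+ 2 + fb f * h%:Z + fc f) | h <- iota 0 p].

(* Number of (x,y) in Z^2 with f(x,y) = n, counted over the box
   |x|,|y| <= N with N = 4(|a|+|c|)n; for a positive definite bqf this box
   contains every solution (see rep_box_complete below). *)
Definition rep_bound (f : bqf) (n : nat) : nat :=
  (4 * (`|fa f| + `|fc f|) * n)%N.

Definition rep (f : bqf) (n : nat) : nat :=
  let N := rep_bound f n in
  (\sum_(i < (N + N).+1) \sum_(j < (N + N).+1)
     (evalf f (i%:Z - N%:Z) (j%:Z - N%:Z) == n%:Z))%N.

(* Coefficient of q^n in the theta series (f, q^k). *)
Definition theta_pow (f : bqf) (k n : nat) : nat :=
  if (k %| n)%N then rep f (n %/ k) else 0%N.

(* Coefficient of q^n in P_{m,r}(f, q). *)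
Definition Pcoef (m r : nat) (f : bqf) (n : nat) : nat :=
  if (n %% m == r)%N then rep f n else 0%N.

Definition legendre (x : int) (p : nat) : int :=
  if (p%:Z %| x)%Z then 0
  else if [exists y : 'I_p, (p%:Z %| (y%:Z ^+ 2 - x))%Z] then 1 else -1.

Definition wD (D : int) : nat :=
  if D == -3 then 3%N else if D == -4 then 2%N else 1%N.

Definition t2 (D : int) : nat :=
  if (16 %| D)%Z then 2%N else if (2 %| D)%Z then 1%N else 0%N.

Lemma int_rth : ring_theory
  (R := GRing.PzSemiRing.sort ssrint_int__canonical__GRing_PzSemiRing)
  0 1 +%R *%R (fun x y => x - y) -%R eq.
Proof.
split=> //; [exact: add0r|exact: addrC|exact: addrA|exact: mul1r|exact: mulrC
 |exact: mulrA|exact: mulrDl|exact: subrr].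
Qed.
Add Ring int_ring : int_rth.

Lemma evalf_id4 (f : bqf) x y :
  4 * fa f * evalf f x y = (2 * fa f * x + fb f * y) ^+ 2 - disc f * y ^+ 2.
Proof. rewrite /evalf /disc !expr2.
have -> : (4%:R : int) = 1 + 1 + 1 + 1 by []. have -> : (2%:R : int) = 1 + 1 by [].
ring. Qed.

Lemma evalf_id4' (f : bqf) x y :
  4 * fc f * evalf f x y = (2 * fc f * y + fb f * x) ^+ 2 - disc f * x ^+ 2.
Proof. rewrite /evalf /disc !expr2.
have -> : (4%:R : int) = 1 + 1 + 1 + 1 by []. have -> : (2%:R : int) = 1 + 1 by [].
ring. Qed.

Lemma box_core (a d s y n : int) : 0 < d -> 4 * a * n = s ^+ 2 + d * y ^+ 2 ->
  `|y| <= 4 * a * n.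
Proof.
move=> d0 e; rewrite e.
have h1 : `|y| <= y ^+ 2.
  case: (eqVneq y 0) => [->|y0]; first by rewrite normr0 expr0n.
  rewrite -real_normK ?num_real // expr2 ler_peMr //; last by rewrite -gtz0_ge1 normr_gt0.
apply: (le_trans h1); rewrite -[y ^+ 2]add0r lerD ?sqr_ge0 //.
by rewrite add0r ler_peMl ?sqr_ge0 // -gtz0_ge1.
Qed.

Lemma posdef_c (f : bqf) : posdef f -> 0 < fc f.
Proof.
case/andP => a0; rewrite /disc subr_lt0 => h.
have : 0 < 4 * fa f * fc f by apply: le_lt_trans h; exact: sqr_ge0.
by rewrite -mulrA pmulr_rgt0 // pmulr_rgt0.
Qed.

Lemma rep_box_complete (f : bqf) (n : nat) (x y : int) :
  posdef f -> evalf f x y = n%:Z ->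
  (`|x| <= rep_bound f n)%N /\ (`|y| <= rep_bound f n)%N.
Proof.
move=> pd e; have c0 := posdef_c pd; have /andP[a0 d0] := pd.
have nd : 0 < - disc f by rewrite oppr_gt0.
split; rewrite -lez_nat abszE /rep_bound !PoszM PoszD !abszE.
- have := evalf_id4' f x y; rewrite e => h.
  have {}h : 4 * fc f * n%:Z = (2 * fc f * y + fb f * x) ^+ 2 + (- disc f) * x ^+ 2
    by rewrite h mulNr.
  have := box_core nd h; move/le_trans; apply.
  by rewrite ler_wpM2r // ler_wpM2l // (gtr0_norm c0) lerDr.
- have := evalf_id4 f x y; rewrite e => h.
  have {}h : 4 * fa f * n%:Z = (2 * fa f * x + fb f * y) ^+ 2 + (- disc f) * y ^+ 2
    by rewrite h mulNr.
  have := box_core nd h; move/le_trans; apply.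
  by rewrite ler_wpM2r // ler_wpM2l // (gtr0_norm a0) lerDl.
Qed.

(* Main.v *)
Require Import Defs.
From HB Require Import structures.
From mathcomp Require Import all_boot all_order all_algebra.
From mathcomp Require Import zify ring.
Set Implicit Arguments. Unset Strict Implicit. Unset Printing Implicit Defensive.
Import Order.TTheory GRing.Theory Num.Theory.
Local Open Scope ring_scope.

(** The forms of [psi_list p f] are the restrictions of [f] to the [p + 1] sublattices
    [L_i] of index [p] in Z^2; [L_i] is generated by [pZ^2] and a vector [v_i], and every
    vector outside [pZ^2] lies in exactly one of them.  Let [q] be [p] for odd [p] and
    [2 ^ (t + 1)] for [p = 2].  The values of [f] prime to [p] on [L_i] all lie in the
    square class of [f v_i] modulo [q], and this class decides whether the restriction
    belongs to the genus [G]: for two lattices with the same class, an element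
    [beta / conj beta] of norm 1 of the quadratic field, with [beta] found by the Chinese
    remainder theorem, carries one lattice onto the other locally at all primes dividing
    [2 p Delta].  Two restrictions are equivalent iff a unit of the order of discriminant
    [Delta] maps one lattice onto the other; units modulo sign act freely, so each class
    of [psi] contains exactly [w] lattices.  Hence [w] times the sum over the classes
    counts the pairs (vector, lattice of the genus containing it): a vector of [pZ^2] is
    counted once for every lattice, any other vector once if its value has the square
    class of [r], and not at all otherwise. *)

(** * Vectors, determinants and divisibility by a prime *)

Definition ivec := (int * int)%type.
Definition qev (f : bqf) (z : ivec) : int := evalf f z.1 z.2.
Definition det2 (z w : ivec) : int := z.1 * w.2 - z.2 * w.1.
Definition pdiv2 (p : nat) (z : ivec) : bool := (p%:Z %| z.1)%Z && (p%:Z %| z.2)%Z.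

Lemma coprimez_prime (p : nat) (x : int) : prime p -> coprimez p%:Z x = ~~ (p%:Z %| x)%Z.
Proof. by move=> pp; rewrite /coprimez /dvdz /gcdz /= -prime_coprime. Qed.

Lemma Euclid_dvdzM (p : nat) (x y : int) : prime p ->
  (p%:Z %| x * y)%Z = (p%:Z %| x)%Z || (p%:Z %| y)%Z.
Proof. by move=> pp; rewrite !dvdzE abszM Euclid_dvdM. Qed.

Lemma prime_inv (p : nat) (x : int) : prime p -> ~~ (p%:Z %| x)%Z ->
  exists y, (p%:Z %| x * y - 1)%Z.
Proof.
move=> pp; rewrite -coprimez_prime // => /coprimezP [[u v] /= e].
exists v; apply/dvdzP; exists (- u); lia.
Qed.

(** * The sublattices of index [p] *)

Section Lattices.
Variables (p : nat) (pp : prime p).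
Implicit Types (i j : option 'I_p) (z w : ivec).

(** The index type [option 'I_p] is the projective line over the field with [p] elements, [None]
    being the point at infinity: a lattice of index [p] is a line modulo [p]. *)
Definition pvec i : ivec := if i is Some h then (h%:Z, 1) else (1, 0).
Definition latmap i z : ivec :=
  if i is Some h then (p%:Z * z.1 + h%:Z * z.2, z.2) else (z.1, p%:Z * z.2).
Definition inlat i z : bool := (p%:Z %| det2 (pvec i) z)%Z.
Definition psi (f : bqf) i : bqf :=
  if i is Some h then
    (fa f * p%:Z ^+ 2, p%:Z * (fb f + 2 * fa f * h%:Z),
     fa f * h%:Z ^+ 2 + fb f * h%:Z + fc f)
  else (fa f, fb f * p%:Z, fc f * p%:Z ^+ 2).

Lemma mem_psi_list f g : reflect (exists i, g = psi f i) (g \in psi_list p f).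
Proof.
rewrite /psi_list inE; apply: (iffP orP) => [[/eqP ->|/mapP [h]]|[[h|] ->]].
- by exists None.
- rewrite mem_iota add0n => hp ->; by exists (Some (Ordinal hp)).
- right; apply/mapP; exists (val h) => //; by rewrite mem_iota add0n ltn_ord.
- by left.
Qed.

Lemma evalf_psi f i x y : evalf (psi f i) x y = qev f (latmap i (x, y)).
Proof. by case: i => [h|]; rewrite /qev /evalf /psi /latmap /fa /fb /fc /=; ring. Qed.

Lemma qev_psi f i z : qev (psi f i) z = qev f (latmap i z).
Proof. by case: z => x y; rewrite /qev evalf_psi. Qed.

Lemma disc_psi f i : disc (psi f i) = disc f * p%:Z ^+ 2.
Proof. by case: i => [h|]; rewrite /disc /fa /fb /fc /=; ring. Qed.

Lemma p_gt0 : 0 < p%:Z. Proof. by rewrite ltz_nat prime_gt0. Qed.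
Lemma p_neq0 : p%:Z != 0. Proof. by rewrite gt_eqF // p_gt0. Qed.

Lemma posdef_psi f i : posdef f -> posdef (psi f i).
Proof.
move=> /andP[a0 d0]; apply/andP; split; last first.
  by rewrite disc_psi pmulr_llt0 // exprn_gt0 // p_gt0.
by case: i => [h|] //; rewrite /= /fa /= mulr_gt0 // exprn_gt0 // p_gt0.
Qed.

Lemma latmap_inj i : injective (latmap i).
Proof.
move=> [x y] [x' y']; case: i => [h|] /= [] e1 e2.
  rewrite e2 in e1 *; congr pair; apply: (mulfI p_neq0); exact: (addIr _ e1).
by congr pair => //; apply: (mulfI p_neq0).
Qed.

Lemma inlat_latmap i z : inlat i (latmap i z).
Proof.
rewrite /inlat; case: i => [h|]; rewrite /det2 /=.
  by apply/dvdzP; exists (- z.1); ring.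
by apply/dvdzP; exists z.2; ring.
Qed.

Lemma inlatP i z : inlat i z -> exists z', z = latmap i z'.
Proof.
rewrite /inlat; case: z => x y; case: i => [h|]; rewrite /det2 /= => /dvdzP [k e].
  exists (- k, y) => /=; congr pair; lia.
exists (x, k) => /=; congr pair; lia.
Qed.

Lemma inlat_pvec i : inlat i (pvec i).
Proof. by rewrite /inlat /det2 mulrC subrr dvdz0. Qed.

Lemma pdiv2_pvec i : ~~ pdiv2 p (pvec i).
Proof.
have h : ~~ (p%:Z %| 1)%Z by rewrite dvdz1 absz_nat; move: (prime_gt1 pp); case: (p) => [|[]].
by rewrite /pdiv2 negb_and; case: i => [i|] /=; rewrite h ?orbT.
Qed.

Lemma pdiv2_inlat i z : pdiv2 p z -> inlat i z.
Proof.
move=> /andP[h1 h2]; rewrite /inlat /det2.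
by apply: rpredB; apply: dvdz_mull.
Qed.

(** Modulo [p] the lattice is a line, spanned by any of its vectors outside [pZ^2]; hence [z] can
    replace [pvec i] in the test. *)
Lemma inlat_det i z w : inlat i z -> ~~ pdiv2 p z -> inlat i w = (p%:Z %| det2 z w)%Z.
Proof.
move=> /inlatP [[x y] ->]; rewrite /pdiv2 /inlat /det2; case: i => [h|] /=.
  case: (boolP (p%:Z %| y)%Z) => hy.
    by rewrite andbT => /negP []; apply: rpredD; [apply: dvdz_mulr|apply: dvdz_mull].
  move=> _; rewrite -(@Gauss_dvdzr p%:Z y) ?coprimez_prime //.
  rewrite [in RHS](_ : _ - _ = p%:Z * (x * w.2) + y * (h%:Z * w.2 - 1 * w.1)); last by ring.
  by rewrite rpredDl //; apply: dvdz_mulr.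
rewrite [(p%:Z %| p%:Z * y)%Z]dvdz_mulr // andbT => hx.
rewrite mul0r subr0 mul1r -(@Gauss_dvdzr p%:Z x) ?coprimez_prime //.
by rewrite -mulrA rpredBr //; apply: dvdz_mulr.
Qed.

Lemma inlat_exists z : exists i, inlat i z.
Proof.
case: z => x y; case: (boolP (p%:Z %| y)%Z) => hy.
  by exists None; rewrite /inlat /det2 /= mul1r mul0r subr0.
have [v /dvdzP [k hv]] := prime_inv pp hy.
(* When [y] is invertible modulo [p] with inverse [v], the line through [(x, y)] also contains
   [(x * v, 1)], which gives the index. *)
have h0 : (0 <= (x * v %% p%:Z)%Z) by rewrite modz_ge0 // p_neq0.
have h1 : (`|(x * v %% p%:Z)%Z| < p)%N.
  by rewrite -ltz_nat gez0_abs // ltz_mod ?p_neq0.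
exists (Some (Ordinal h1)); rewrite /inlat /det2 /= gez0_abs // mul1r.
apply/dvdzP; exists (k * x - (x * v %/ p%:Z)%Z * y).
have := divz_eq (x * v) p%:Z; move: (x * v %/ p%:Z)%Z (x * v %% p%:Z)%Z => q m e.
have -> : m = x * v - q * p%:Z by rewrite e addrC addKr.
have -> : (x * v - q * p%:Z) * y - x = x * (y * v - 1) - q * p%:Z * y by ring.
by rewrite hv; ring.
Qed.

Lemma inlat_uniq i j z : ~~ pdiv2 p z -> inlat i z -> inlat j z -> i = j.
Proof.
move=> hz hi hj.
have h : inlat i (pvec j).
  rewrite (inlat_det _ hi hz).
  by rewrite -(inlat_det _ hj hz) inlat_pvec.
move: h; rewrite /inlat /det2; case: i {hi} => [h|]; case: j {hj} => [h'|] //=.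
- rewrite mulr1 mul1r => d; congr Some; apply/val_inj => /=.
  have := ltn_ord h; have := ltn_ord h'; move: (val h) (val h') d => a b d; move: pp.
  case/dvdzP: d => k hk _.
  (* Two residues in [[0, p)] differ by [k * p], which leaves only [k = 0]. *)
  have [k0|[k0|k0]] : k = 0 \/ (k <= -1) \/ (1 <= k) by lia.
  - by move: hk; rewrite k0; lia.
  - nia.
  - nia.
- rewrite mulr0 mulr1 sub0r rpredN => h1; have := pdiv2_pvec None.
  by rewrite /pdiv2 /= h1 dvdz0.
- rewrite mulr1 mul0r subr0 => h1; have := pdiv2_pvec None.
  by rewrite /pdiv2 /= h1 dvdz0.
Qed.

End Lattices.

(** * Square classes of the values *)

Definition sqmod (q : nat) (x : int) : bool :=
  [exists y : 'I_q, (q%:Z %| y%:Z ^+ 2 - x)%Z].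

Lemma sqmodP (q : nat) (x : int) : (0 < q)%N ->
  reflect (exists y, (q%:Z %| y ^+ 2 - x)%Z) (sqmod q x).
Proof.
move=> q0; apply: (iffP existsP) => [[y hy]|[y hy]]; first by exists y%:Z.
have qn0 : q%:Z != 0 by rewrite -lt0n in q0 *; lia.
have h0 : (0 <= (y %% q%:Z)%Z) by rewrite modz_ge0.
have h1 : (`|(y %% q%:Z)%Z| < q)%N by rewrite -ltz_nat gez0_abs // ltz_mod.
exists (Ordinal h1) => /=; rewrite gez0_abs //.
have e := divz_eq y q%:Z; move: e hy; move: (y %/ q%:Z)%Z (y %% q%:Z)%Z => k m e.
rewrite e [X in (_ %| X)%Z -> _](_ : _ = (m ^+ 2 - x) + q%:Z * (k * (k * q%:Z + 2 * m))); last by ring.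
by rewrite rpredDr //; apply: dvdz_mulr.
Qed.

(* The modulus whose square classes separate the genera meeting [psi]. *)
Definition qmod (p : nat) (D : int) : nat := if p == 2%N then (2 ^ (t2 D).+1)%N else p.

(** For [r] prime to [p], the product [r * n] being a square says that [n] and [r] have the same
    square class. *)
Definition good (p : nat) (D r n : int) : bool :=
  ~~ (p%:Z %| n)%Z && sqmod (qmod p D) (r * n).

(** The polar form of [f], the mixed term in the value of [f] at [v + w]. *)
Definition bil (f : bqf) (v w : ivec) : int :=
  2 * fa f * v.1 * w.1 + fb f * (v.1 * w.2 + v.2 * w.1) + 2 * fc f * v.2 * w.2.

Definition comb (x k : int) (v w : ivec) : ivec := (x * v.1 + k * w.1, x * v.2 + k * w.2).

Lemma qev_comb f x k v w :
  qev f (comb x k v w) = x ^+ 2 * qev f v + k * (x * bil f v w) + k ^+ 2 * qev f w.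
Proof. rewrite /qev /evalf /bil /comb /=; ring. Qed.

Lemma bil_disc f v w :
  bil f v w ^+ 2 - 4 * qev f v * qev f w = disc f * det2 v w ^+ 2.
Proof. rewrite /qev /evalf /bil /disc /det2 /=; ring. Qed.

Lemma dvd2_odd (x : int) : ~~ (2%:Z %| x)%Z -> exists k, x = 2 * k + 1.
Proof. by move=> h; exists (x %/ 2)%Z; lia. Qed.

Lemma dvd2_mulS (x : int) : (2 %| x * (x + 1))%Z.
Proof. by rewrite (Euclid_dvdzM x (x+1) (isT : prime 2)); lia. Qed.

Section Values.
Variables (p : nat) (pp : prime p).

Lemma qmod_pow D : exists e, qmod p D = (p ^ e.+1)%N.
Proof.
rewrite /qmod; case: eqP => [->|_]; first by exists (t2 D).
by exists 0%N; rewrite expn1.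
Qed.

Lemma qmod_gt0 D : (0 < qmod p D)%N.
Proof. by have [e ->] := qmod_pow D; rewrite expn_gt0 prime_gt0. Qed.

Lemma dvdp_qmod D : (p%:Z %| (qmod p D)%:Z)%Z.
Proof. by have [e ->] := qmod_pow D; rewrite expnS PoszM dvdz_mulr. Qed.

Lemma coprimez_qmod D x : ~~ (p%:Z %| x)%Z -> coprimez (qmod p D)%:Z x.
Proof.
have [e ->] := qmod_pow D; rewrite -coprimez_prime //.
by rewrite !coprimezE !absz_nat coprime_pexpl.
Qed.

Lemma good_congr D r m n : ((qmod p D)%:Z %| m - n)%Z -> good p D r m = good p D r n.
Proof.
move=> h; rewrite /good.
have -> : (p%:Z %| m)%Z = (p%:Z %| n)%Z.
  have h1 := dvdz_trans (dvdp_qmod D) h.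
  by rewrite -[m](subrK n) rpredDl.
congr (_ && _); apply/(sqmodP _ (qmod_gt0 D))/(sqmodP _ (qmod_gt0 D)) => [] [y hy]; exists y.
  have -> : y ^+ 2 - r * n = (y ^+ 2 - r * m) + r * (m - n) by ring.
  by apply: rpredD => //; apply: dvdz_mull.
have -> : y ^+ 2 - r * m = (y ^+ 2 - r * n) - r * (m - n) by ring.
by apply: rpredB => //; apply: dvdz_mull.
Qed.

Lemma good_mulsq D r x n : ~~ (p%:Z %| x)%Z -> good p D r (x ^+ 2 * n) = good p D r n.
Proof.
move=> hx; rewrite /good !Euclid_dvdzM // (negbTE hx) /=.
congr (_ && _); apply/(sqmodP _ (qmod_gt0 D))/(sqmodP _ (qmod_gt0 D)) => [] [y hy].
  have /coprimezP[[u v] /= e] := coprimez_qmod D hx.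
  exists (y * v).
  have -> : (y * v) ^+ 2 - r * n =
    v ^+ 2 * (y ^+ 2 - r * (x ^+ 2 * n)) + ((v * x) ^+ 2 - 1) * (r * n) by ring.
  apply: rpredD; first by apply: dvdz_mull.
  apply: dvdz_mulr; have -> : v * x = 1 - u * (qmod p D)%:Z by rewrite -e; ring.
  by apply/dvdzP; exists (u * (u * (qmod p D)%:Z - 2)); ring.
exists (x * y).
have -> : (x * y) ^+ 2 - r * (x ^+ 2 * n) = x ^+ 2 * (y ^+ 2 - r * n) by ring.
by apply: dvdz_mull.
Qed.

(* If [p = 2] and [16 %| D] then [B = 2 B'] with [B' = F] modulo [2]. *)
Lemma qmod_cross D x A B F e : ~~ (p%:Z %| x)%Z -> ~~ (p%:Z %| A)%Z ->
  B ^+ 2 - 4 * A * F = D * e ^+ 2 ->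
  ((qmod p D)%:Z %| p%:Z * (x * B) + p%:Z ^+ 2 * F)%Z.
Proof.
rewrite /qmod; case: eqP => [->|_] hx hA eD; last first.
  by apply: rpredD; [apply: dvdz_mulr|rewrite expr2 -mulrA; apply: dvdz_mulr].
have [x' ex] := dvd2_odd hx; have [A' eA] := dvd2_odd hA.
(* The modulus is [8] in this case, [4] in the next one and [2] in the last. *)
rewrite /t2; case: ifP => [/dvdzP [D' eD']|_].
  have : (2 %| B)%Z.
    have : (2%:Z %| B ^+ 2)%Z.
      rewrite (_ : B ^+ 2 = 4 * A * F + D * e ^+ 2); last by rewrite -eD; ring.
      apply/dvdzP; exists (2 * A * F + D' * 8 * e ^+ 2); rewrite eD'; ring.
    by rewrite expr2 (Euclid_dvdzM _ _ (isT : prime 2)) orbb.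
  move=> /dvdzP [B' eB]; have /dvdzP [m em] := dvd2_mulS B'.
  have h : B' ^+ 2 - A * F = 4 * (D' * e ^+ 2).
    apply: (mulfI (_ : (4 : int) != 0)) => //.
    transitivity (B ^+ 2 - 4 * A * F); first by rewrite eB; ring.
    by rewrite eD eD'; ring.
  apply/dvdzP; exists (m + x' * B' - A' * F - 2 * (D' * e ^+ 2)).
  have eF : F = B' * (B' + 1) - B' - 2 * A' * F - 4 * (D' * e ^+ 2).
    by rewrite -h eA; ring.
  transitivity (4 * (x * B' + F)); first by rewrite eB; ring.
  by rewrite {1}eF ex em (_ : (2 ^ 3)%N%:Z = 8) //; ring.
case: ifP => [/dvdzP [D' eD']|_].
  have : (2 %| B)%Z.
    have : (2%:Z %| B ^+ 2)%Z.
      rewrite (_ : B ^+ 2 = 4 * A * F + D * e ^+ 2); last by rewrite -eD; ring.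
      apply/dvdzP; exists (2 * A * F + D' * e ^+ 2); rewrite eD'; ring.
    by rewrite expr2 (Euclid_dvdzM _ _ (isT : prime 2)) orbb.
  move=> /dvdzP [B' eB]; apply/dvdzP; exists (x * B' + F).
  by rewrite eB (_ : (2 ^ 2)%N%:Z = 4) //; ring.
by apply/dvdzP; exists (x * B + 2 * F); rewrite expn1; ring.
Qed.

Lemma inlat_comb i z : @inlat p i z -> ~~ pdiv2 p z ->
  exists x w, z = comb x p%:Z (pvec i) w /\ ~~ (p%:Z %| x)%Z.
Proof.
move=> /(inlatP pp) [[x y] ->]; case: i => [h|] /= hz.
  exists y, (x, 0); split; first by rewrite /comb /=; congr pair; ring.
  apply: contra hz => hy; rewrite /pdiv2 /= hy andbT.
  by apply: rpredD; [apply: dvdz_mulr|apply: dvdz_mull].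
exists x, (0, y); split; first by rewrite /comb /=; congr pair; ring.
by apply: contra hz => hx; rewrite /pdiv2 /= hx dvdz_mulr.
Qed.

(** Write [z] as [x] times [pvec i] plus [p] times [w], with [x] prime to [p]. The value at [z] is
    [x ^ 2] times that at [pvec i], plus terms that vanish modulo [qmod] by [qmod_cross]. If [p]
    divides the value at [pvec i], both sides are false. *)
Lemma good_inlat f r i z : @inlat p i z -> ~~ pdiv2 p z ->
  good p (disc f) r (qev f z) = good p (disc f) r (qev f (pvec i)).
Proof.
move=> hi hz; have [x [w [-> hx]]] := inlat_comb hi hz.
rewrite qev_comb -addrA; case: (boolP (p%:Z %| qev f (pvec i))%Z) => hv.
  rewrite /good hv /=; rewrite [X in ~~ X](_ : _ = true) //.
  apply: rpredD; first by apply: dvdz_mull.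
  by apply: rpredD; [apply: dvdz_mulr|rewrite expr2 -mulrA; apply: dvdz_mulr].
rewrite -[RHS](good_mulsq _ _ _ hx); apply: good_congr; rewrite addrAC subrr add0r.
exact: qmod_cross hx hv (bil_disc f (pvec i) w).
Qed.

End Values.

(** * Equivalence classes within [psi] as orbits of units *)

(* [umul f u] is the matrix [s + t * Omega] with [Omega = [[0, -c], [a, b]]],
   that is, multiplication by an element of the quadratic order of [f]. *)
Definition umul (f : bqf) (u z : ivec) : ivec :=
  (u.1 * z.1 - u.2 * fc f * z.2, u.2 * fa f * z.1 + (u.1 + fb f * u.2) * z.2).

(** The determinant of [umul f u], that is, the norm form of the order of discriminant [disc f]. *)
Definition nrm (f : bqf) (u : ivec) : int :=
  u.1 ^+ 2 + fb f * u.1 * u.2 + fa f * fc f * u.2 ^+ 2.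

Lemma qev_umul f u z : qev f (umul f u z) = nrm f u * qev f z.
Proof. rewrite /qev /evalf /umul /nrm /=; ring. Qed.

Lemma det2_umul f u z w : det2 (umul f u z) (umul f u w) = nrm f u * det2 z w.
Proof. rewrite /det2 /umul /nrm /=; ring. Qed.

(** This detects when two multiples of one vector are proportional modulo [p]: if [p] does not
    divide the value at [z], then [p] must divide [det2 u u']. *)
Lemma det2_umul2 f u u' z :
  det2 (umul f u z) (umul f u' z) = det2 u u' * qev f z.
Proof. rewrite /det2 /umul /qev /evalf /=; ring. Qed.

Lemma umulN f u z : umul f (- u.1, - u.2) z = (- (umul f u z).1, - (umul f u z).2).
Proof. rewrite /umul /=; congr pair; ring. Qed.

Lemma primitive_dvd f d x : primitive f ->
  (d %| fa f * x)%Z -> (d %| fb f * x)%Z -> (d %| fc f * x)%Z -> (d %| x)%Z.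
Proof.
move=> /eqP pf ha hb hc.
have [u1 [v1 e1]] := Bezoutz (fa f) (fb f).
have [u2 [v2 e2]] := Bezoutz (gcdz (fa f) (fb f)) (fc f).
rewrite -[x]mul1r -pf -e2 -e1.
rewrite [X in (_ %| X)%Z](_ : _ = (u2 * u1) * (fa f * x) + (u2 * v1) * (fb f * x) + v2 * (fc f * x)); last by ring.
by apply: rpredD; [apply: rpredD|]; apply: dvdz_mull.
Qed.

(* With [F] the Gram matrix, [E^T F E = N F] and [det E = N] give [F E = adj(E)^T F]. *)
Lemma similitude_umul f (e11 e12 e21 e22 N : int) :
  primitive f -> fa f != 0 -> N != 0 -> e11 * e22 - e12 * e21 = N ->
  (forall x y, evalf f (e11 * x + e12 * y) (e21 * x + e22 * y) = N * evalf f x y) ->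
  exists u, nrm f u = N /\
    forall x y, (e11 * x + e12 * y, e21 * x + e22 * y) = umul f u (x, y).
Proof.
move=> pf a0 N0 eN hE.
have hi := hE 1 0; have hiii := hE 0 1; have hii := hE 1 1.
have [a [b [c [ea eb ec]]]] : exists a b c, [/\ fa f = a, fb f = b & fc f = c].
  by exists (fa f), (fb f), (fc f).
rewrite /evalf ea eb ec in hi hii hiii a0.
have {}hi : a * e11 ^+ 2 + b * e11 * e21 + c * e21 ^+ 2 = N * a.
  by move: hi; rewrite !(mulr1, mulr0, addr0, expr1n, expr0n).
have {}hiii : a * e12 ^+ 2 + b * e12 * e22 + c * e22 ^+ 2 = N * c.
  by move: hiii; rewrite !(mulr1, mulr0, addr0, add0r, expr1n, expr0n).
(* Polarization: the mixed term is the value at [(1, 1)] minus those at the two basis vectors. *)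
have {}hii : 2 * a * e11 * e12 + b * (e11 * e22 + e12 * e21) + 2 * c * e21 * e22 = N * b.
  have : (a * e11 ^+ 2 + b * e11 * e21 + c * e21 ^+ 2) +
     (2 * a * e11 * e12 + b * (e11 * e22 + e12 * e21) + 2 * c * e21 * e22)
    + (a * e12 ^+ 2 + b * e12 * e22 + c * e22 ^+ 2) = N * (a + b + c).
    by transitivity (N * (a * 1 ^+ 2 + b * 1 * 1 + c * 1 ^+ 2)); [rewrite -hii|]; ring.
  rewrite hi hiii => h; apply: (addrI (N * a)); apply: (addIr (N * c)); rewrite h; ring.
have h11 : a * e11 + b * e21 = a * e22.
  apply: (mulfI (_ : 2 * N != 0)); first by rewrite mulf_neq0.
  transitivity (e22 * 2 * (N * a) - e21 * (N * b) + N * b * e21); last by ring.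
  by rewrite -{1}hi -{1}hii -eN; ring.
have h12 : a * e12 = - c * e21.
  apply: (mulfI (_ : 2 * N != 0)); first by rewrite mulf_neq0.
  transitivity (e22 * (N * b) - e21 * 2 * (N * c) - N * b * e22); last by ring.
  by rewrite -{1}hiii -{1}hii -eN; ring.
(* The products of [e21] with [a], [b] and [c] are all multiples of [a], so primitivity applies; the
   quotient is the coefficient of [Omega]. *)
have : (a %| e21)%Z.
  apply: (primitive_dvd pf); rewrite ?ea ?eb ?ec.
  - exact: dvdz_mulr.
  - by rewrite (_ : b * e21 = a * (e22 - e11)) ?dvdz_mulr // mulrBr -h11; ring.
  - by rewrite (_ : c * e21 = a * - e12) ?dvdz_mulr // mulrN h12; ring.
move=> /dvdzP [t et].
have e22E : e22 = e11 + b * t.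
  by apply: (mulfI a0); rewrite -h11 et; ring.
have e12E : e12 = - (t * c).
  by apply: (mulfI a0); rewrite h12 et; ring.
exists (e11, t); split.
  by rewrite /nrm ea eb ec /= -eN e22E e12E et; ring.
by move=> x y; rewrite /umul ea eb ec /= e22E e12E et; congr pair; ring.
Qed.

(** Elements of norm 1 up to sign. By [nrm4] they solve [(2 * s + b * t) ^ 2 - D * t ^ 2 = 4]; the
    entries with [t = 1] come from [2 * s + b = 1] or [-1] when [D = -3], and from [2 * s + b = 0]
    when [D = -4]. *)
Definition units (f : bqf) : seq ivec :=
  if disc f == -3 then [:: (1, 0); (((1 - fb f) %/ 2)%Z, 1); (((-1 - fb f) %/ 2)%Z, 1)]
  else if disc f == -4 then [:: (1, 0); ((- fb f %/ 2)%Z, 1)]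
  else [:: (1, 0)].

Lemma size_units f : size (units f) = wD (disc f).
Proof. by rewrite /units /wD; case: ifP => //; case: ifP. Qed.

(** The discriminant determines the parity of [fb f], so the halves in [units] are exact. *)
Lemma disc_mod4 f : exists k e : int, [/\ disc f = 4 * k + e, fb f = 2 * (fb f %/ 2)%Z + e & e = 0 \/ e = 1].
Proof.
exists ((fb f %/ 2)%Z ^+ 2 + (fb f %/ 2)%Z * (fb f %% 2)%Z - fa f * fc f), (fb f %% 2)%Z.
have e : fb f = 2 * (fb f %/ 2)%Z + (fb f %% 2)%Z by lia.
have e01 : (fb f %% 2)%Z = 0 \/ (fb f %% 2)%Z = 1 by lia.
split=> //; rewrite /disc {1}e; move: e01; move: (fb f %/ 2)%Z (fb f %% 2)%Z => m n.
by case=> ->; ring.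
Qed.

Lemma nrm4 f u : 4 * nrm f u = (2 * u.1 + fb f * u.2) ^+ 2 - disc f * u.2 ^+ 2.
Proof. rewrite /nrm /disc; ring. Qed.

Lemma nrm_units f u : u \in units f -> nrm f u = 1.
Proof.
have [k [e [eD eb e01]]] := disc_mod4 f.
move=> hu; apply: (mulfI (_ : (4 : int) != 0)) => //; rewrite nrm4; move: hu.
rewrite /units; case: eqP => [d3|_].
  have e1 : e = 1 by lia.
  have -> : ((1 - fb f) %/ 2)%Z = - (fb f %/ 2)%Z by lia.
  have -> : ((-1 - fb f) %/ 2)%Z = - (fb f %/ 2)%Z - 1 by lia.
  rewrite d3 !inE eb e1; move: (fb f %/ 2)%Z => m.
  have -> : ((2 * m + 1) %/ 2)%Z = m by lia.
  by case/or3P => /eqP -> /=; ring.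
case: eqP => [d4|_].
  have e1 : e = 0 by lia.
  have -> : (- fb f %/ 2)%Z = - (fb f %/ 2)%Z by lia.
  rewrite d4 !inE eb e1; move: (fb f %/ 2)%Z => m.
  have -> : ((2 * m + 0) %/ 2)%Z = m by lia.
  by case/orP => /eqP -> /=; ring.
by rewrite inE => /eqP -> /=; ring.
Qed.

Lemma units_complete f u : posdef f -> nrm f u = 1 ->
  u \in units f \/ (- u.1, - u.2) \in units f.
Proof.
case: u => s t /andP[_ d0] hu; have := nrm4 f (s, t); rewrite hu /= mulr1.
have [k [e [eD eb e01]]] := disc_mod4 f.
rewrite /units; set b := fb f in eb *; set D := disc f in eD d0 *; move: eD eb d0 => eD eb d0 hn.
have ht : D * t ^+ 2 >= -4 by have := sqr_ge0 (2 * s + b * t); lia.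
case: eqP => [d3|n3].
  have [t0|[t0|t0]] : t = 0 \/ t = 1 \/ t = -1 by rewrite d3 in ht; nia.
  - have [s1|s1] : s = 1 \/ s = -1 by rewrite t0 in hn; nia.
    + by left; rewrite s1 t0 inE eqxx.
    + by right; rewrite s1 t0 inE eqxx.
  - have {}hn : (2 * s + b) ^+ 2 = 1 by move: hn; rewrite t0 d3; lia.
    have [h|h] : 2 * s + b = 1 \/ 2 * s + b = -1 by nia.
    + by left; rewrite t0 (_ : s = ((1 - b) %/ 2)%Z) ?inE ?eqxx ?orbT //; lia.
    + by left; rewrite t0 (_ : s = ((-1 - b) %/ 2)%Z) ?inE ?eqxx ?orbT //; lia.
  - have {}hn : (2 * s - b) ^+ 2 = 1 by move: hn; rewrite t0 d3; lia.
    have [h|h] : 2 * s - b = 1 \/ 2 * s - b = -1 by nia.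
    + by right; rewrite t0 opprK /= (_ : - s = ((-1 - b) %/ 2)%Z) ?inE ?eqxx ?orbT //; lia.
    + by right; rewrite t0 opprK /= (_ : - s = ((1 - b) %/ 2)%Z) ?inE ?eqxx ?orbT //; lia.
case: eqP => [d4|n4].
  have [t0|[t0|t0]] : t = 0 \/ t = 1 \/ t = -1 by rewrite d4 in ht; nia.
  - have [s1|s1] : s = 1 \/ s = -1 by rewrite t0 in hn; nia.
    + by left; rewrite s1 t0 inE eqxx.
    + by right; rewrite s1 t0 inE eqxx.
  - have {}hn : (2 * s + b) ^+ 2 = 0 by move: hn; rewrite t0 d4; lia.
    have h : 2 * s + b = 0 by nia.
    by left; rewrite t0 (_ : s = (- b %/ 2)%Z) ?inE ?eqxx ?orbT //; lia.
  - have {}hn : (2 * s - b) ^+ 2 = 0 by move: hn; rewrite t0 d4; lia.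
    have h : 2 * s - b = 0 by nia.
    by right; rewrite t0 opprK /= (_ : - s = (- b %/ 2)%Z) ?inE ?eqxx ?orbT //; lia.
(* The values [-1] and [-2] are excluded modulo [4]; now [-4 <= D * t ^ 2] forces [t = 0]. *)
have D5 : D <= -5 by lia.
have t0 : t = 0 by nia.
have [s1|s1] : s = 1 \/ s = -1 by rewrite t0 in hn; nia.
  by left; rewrite t0 s1 inE eqxx.
by right; rewrite t0 s1 inE eqxx.
Qed.

(** Together with [det2_umul2] this makes the action of the units modulo sign on the lattices
    free. *)
Lemma det2_units f u u' : u \in units f -> u' \in units f -> u != u' ->
  `|det2 u u'| = 1.
Proof.
have [k [e [eD eb e01]]] := disc_mod4 f.
rewrite /units; case: eqP => [d3|_]; last case: eqP => [d4|_].
- have -> : ((1 - fb f) %/ 2)%Z = ((-1 - fb f) %/ 2)%Z + 1 by lia.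
  move: (_ %/ _)%Z => m; rewrite !inE.
  by case/or3P => /eqP ->; case/or3P => /eqP ->; rewrite ?eqxx // => _;
    rewrite /det2 /=; lia.
- move: (_ %/ _)%Z => m; rewrite !inE.
  by case/orP => /eqP ->; case/orP => /eqP ->; rewrite ?eqxx // => _;
    rewrite /det2 /=; lia.
by rewrite !inE => /eqP -> /eqP ->; rewrite eqxx.
Qed.

Lemma uniq_units f : uniq (units f).
Proof.
rewrite /units; case: ifP => _; last by case: ifP => _ //; rewrite /= !inE !xpair_eqE /=; lia.
rewrite /= !inE !xpair_eqE /=; lia.
Qed.

(** * Equivalent restrictions and lattices related by a unit *)

Section Classes.
Variables (p : nat) (pp : prime p) (f : bqf) (pf : primitive f) (df : posdef f).
Implicit Types i j : option 'I_p.

Lemma det2_latmap i z w : det2 (latmap i z) (latmap i w) = p%:Z * det2 z w.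
Proof. case: i => [h|]; rewrite /det2 /=; ring. Qed.

Lemma latmap_comb i x y z w : latmap i (comb x y z w) = comb x y (latmap i z) (latmap i w).
Proof. case: i => [h|]; rewrite /comb /=; congr pair; ring. Qed.

Lemma umul_comb u x y z w : umul f u (comb x y z w) = comb x y (umul f u z) (umul f u w).
Proof. rewrite /umul /comb /=; congr pair; ring. Qed.

Lemma fa_neq0 : fa f != 0. Proof. by case/andP: df => h _; rewrite gt_eqF. Qed.

(** The lattice of [j] is generated by [pZ^2] and [pvec j], so testing the single vector [pvec j]
    suffices. *)
Lemma inlat_umul_latmap i j u z : inlat i (umul f u (pvec j)) ->
  inlat i (umul f u (latmap j z)).
Proof.
rewrite /inlat; case: z => x y; case: j => [h|] /dvdzP [k hk]; apply/dvdzP;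
  rewrite /det2 /umul /= in hk *.
- exists (y * k + (pvec i).1 * (u.2 * fa f) * x - (pvec i).2 * u.1 * x).
  transitivity (y * (k * p%:Z) + ((pvec i).1 * (u.2 * fa f) * x - (pvec i).2 * u.1 * x) * p%:Z);
    by [rewrite -hk; ring|ring].
- exists (x * k + (pvec i).1 * ((u.1 + fb f * u.2) * y) + (pvec i).2 * u.2 * fc f * y).
  transitivity (x * (k * p%:Z) +
      ((pvec i).1 * ((u.1 + fb f * u.2) * y) + (pvec i).2 * u.2 * fc f * y) * p%:Z);
    by [rewrite -hk; ring|ring].
Qed.

(** Two vectors of a lattice of index [p] with determinant [p] form an oriented basis of it, and [g]
    is [f] written in that basis. *)
Lemma sl2_equiv_basis i (g : bqf) z w : inlat i z -> inlat i w -> det2 z w = p%:Z ->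
  (forall x y, evalf g x y = qev f (comb x y z w)) -> sl2_equiv (psi f i) g.
Proof.
move=> /(inlatP pp) [[al ga] ->] /(inlatP pp) [[be de] ->] hd hg.
exists al, be, ga, de; split.
  apply: (mulfI (p_neq0 pp)); by rewrite mulr1 -[RHS]hd det2_latmap /det2 /=; ring.
move=> x y; rewrite evalf_psi hg -latmap_comb /comb /=; congr (qev f (latmap i _)).
by congr pair; ring.
Qed.

Lemma sl2_equiv_psi i j u : nrm f u = 1 -> inlat i (umul f u (pvec j)) ->
  sl2_equiv (psi f i) (psi f j).
Proof.
move=> hu hin.
apply: (@sl2_equiv_basis i _ (umul f u (latmap j (1, 0))) (umul f u (latmap j (0, 1)))).
- exact: inlat_umul_latmap.
- exact: inlat_umul_latmap.
- by rewrite det2_umul hu det2_latmap /det2 /=; ring.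
move=> x y; rewrite -umul_comb qev_umul hu mul1r -latmap_comb evalf_psi.
by congr (qev f (latmap j _)); rewrite /comb /=; congr pair; ring.
Qed.

(** The adjugate of the matrix of [latmap i], an integral substitute for its inverse. *)
Definition padj i (z : ivec) : ivec :=
  if i is Some h then (z.1 - h%:Z * z.2, p%:Z * z.2) else (p%:Z * z.1, z.2).

Lemma latmap_padj i z : latmap i (padj i z) = (p%:Z * z.1, p%:Z * z.2).
Proof. case: i => [h|]; rewrite /=; congr pair; ring. Qed.

Lemma padj_pvec i : exists e : ivec, padj i (pvec i) = (p%:Z * e.1, p%:Z * e.2).
Proof.
by case: i => [h|]; [exists (0, 1)|exists (1, 0)] => /=; congr pair; ring.
Qed.

(** Conjugating the equivalence [X] by the two lattice maps gives a similitude [E] of [f] with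
    factor [p ^ 2], hence multiplication by some [(s, t)] of norm [p ^ 2]. Both coordinates turn out
    divisible by [p], and the quotient is the unit sought. *)
Lemma psi_sl2_equiv i j : ~~ (p%:Z %| qev f (pvec j))%Z ->
  sl2_equiv (psi f i) (psi f j) ->
  exists u, nrm f u = 1 /\ inlat i (umul f u (pvec j)).
Proof.
move=> hj [al [be [ga [de [hdet hX]]]]].
pose X (z : ivec) := (al * z.1 + be * z.2, ga * z.1 + de * z.2).
pose E z := latmap i (X (padj j z)).
have linE x y : E (x, y) = comb x y (E (1, 0)) (E (0, 1)).
  by rewrite /E /X /comb; case: (i) => [h|]; case: (j) => [h'|] /=; congr pair; ring.
have p0 := p_neq0 pp.
have [] := @similitude_umul f (E (1, 0)).1 (E (0, 1)).1 (E (1, 0)).2 (E (0, 1)).2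
  (p%:Z ^+ 2) pf fa_neq0 (expf_neq0 2 p0).
- have -> : (E (1, 0)).1 * (E (0, 1)).2 - (E (0, 1)).1 * (E (1, 0)).2 =
    (al * de - be * ga) * p%:Z ^+ 2; last by rewrite hdet mul1r.
  by rewrite /E /X; case: (i) => [h|]; case: (j) => [h'|] /=; ring.
- move=> x y.
  have -> : evalf f ((E (1, 0)).1 * x + (E (0, 1)).1 * y) ((E (1, 0)).2 * x + (E (0, 1)).2 * y)
    = qev f (E (x, y)).
    by rewrite (linE x y) /comb /qev; congr evalf => /=; ring.
  rewrite /E -qev_psi /X {1}/qev -hX -[evalf _ _ _]/(qev _ (padj j (x, y))) qev_psi latmap_padj /qev /evalf /=; ring.
move=> [s t] [hn hu].
have {}hu z : E z = umul f (s, t) z.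
  by case: z => x y; rewrite -hu (linE x y) /comb; congr pair; ring.
have [e he] := padj_pvec j.
pose w := latmap i (X e).
have hw : umul f (s, t) (pvec j) = (p%:Z * w.1, p%:Z * w.2).
  rewrite -hu /E he /w /X; case: (i) => [h|] /=; congr pair; ring.
(* The determinant of [pvec j] and its image is [t] times the value at [pvec j], and the image lies
   in [pZ^2]. *)
have ht : (p%:Z %| t)%Z.
  have : (p%:Z %| det2 (umul f (1, 0) (pvec j)) (umul f (s, t) (pvec j)))%Z.
    rewrite hw; apply/dvdzP; exists (det2 (umul f (1, 0) (pvec j)) w); rewrite /det2 /=; ring.
  by rewrite det2_umul2 Euclid_dvdzM // (negbTE hj) orbF /det2 /= mul1r mul0r subr0.
have hs : (p%:Z %| s)%Z.
  move: ht hw; rewrite /umul; case: (j) => [h|] /= /dvdzP [t' ->] [h1 h2].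
    apply/dvdzP; exists (w.2 - t' * fa f * h%:Z - fb f * t').
    by rewrite !mulrBl [w.2 * _]mulrC -h2; ring.
  apply/dvdzP; exists w.1; move: h1; lia.
move: ht hs => /dvdzP [t' et] /dvdzP [s' es].
exists (s', t'); split.
  apply: (mulfI (expf_neq0 2 p0)); rewrite mulr1 -[RHS]hn es et /nrm /=; ring.
have -> : umul f (s', t') (pvec j) = w; last exact: inlat_latmap.
case: w hw => w1 w2; rewrite es et /umul /= => [] [h1 h2].
by congr pair; apply: (mulfI p0); rewrite -?h1 -?h2; ring.
Qed.

Definition psieqv i j : bool := has (fun u => inlat i (umul f u (pvec j))) (units f).

Lemma psieqvP i j : ~~ (p%:Z %| qev f (pvec j))%Z ->
  reflect (sl2_equiv (psi f i) (psi f j)) (psieqv i j).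
Proof.
move=> hj; apply: (iffP hasP) => [[u hu hin]|].
  exact: sl2_equiv_psi (nrm_units hu) hin.
move=> /(psi_sl2_equiv hj) [u [hn hin]].
case: (units_complete df hn) => hu; first by exists u.
exists (- u.1, - u.2) => //; rewrite umulN; move: hin; rewrite /inlat /det2 /=.
by rewrite !mulrN -opprD rpredN.
Qed.

Lemma qev_pdiv2 z : ~~ (p%:Z %| qev f z)%Z -> ~~ pdiv2 p z.
Proof.
apply: contra => /andP [/dvdzP [x ex] /dvdzP [y ey]].
by apply/dvdzP; exists (p%:Z * qev f (x, y)); rewrite /qev /evalf ex ey /=; ring.
Qed.

(** Each unit sends [pvec j] outside [pZ^2], hence into exactly one lattice, and different units
    give different lattices. *)
Lemma card_psieqv j : ~~ (p%:Z %| qev f (pvec j))%Z -> #|[pred i | psieqv i j]| = wD (disc f).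
Proof.
move=> hj.
pose idx z := odflt None [pick i : option 'I_p | inlat i z].
have idxP z : inlat (idx z) z.
  rewrite /idx; case: pickP => [i //|h].
  by have [i hi] := inlat_exists pp z; rewrite h in hi.
have hq u : u \in units f -> ~~ pdiv2 p (umul f u (pvec j)).
  by move=> hu; apply: qev_pdiv2; rewrite qev_umul (nrm_units hu) mul1r.
pose s := [seq idx (umul f u (pvec j)) | u <- units f].
have us : uniq s.
  rewrite map_inj_in_uniq ?uniq_units // => u u' hu hu' e.
  apply/eqP; case: (eqVneq u u') => // /(det2_units hu hu') hd.
  have h1 := idxP (umul f u (pvec j)); have := idxP (umul f u' (pvec j)).
  rewrite -e (inlat_det pp _ h1 (hq _ hu)) det2_umul2 Euclid_dvdzM // (negbTE hj) orbF.
  have {}hd : `|det2 u u'|%N = 1%N by lia.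
  by rewrite dvdzE hd dvdn1 absz_nat gtn_eqF // prime_gt1.
rewrite -size_units -(size_map (fun u => idx (umul f u (pvec j))) (units f)) -/s.
rewrite -(card_uniqP us); apply: eq_card => i; rewrite inE.
apply/hasP/mapP => [[u hu hin]|[u hu ->]]; last by exists u.
by exists u => //; apply: (inlat_uniq pp (hq u hu) hin).
Qed.

End Classes.

(** * Genera within [psi] *)

Lemma same_genus_trans D f g h : same_genus D f g -> same_genus D g h -> same_genus D f h.
Proof.
move=> [a1 [b1 [c1 [d1 [e1 [n1 [cop1 [det1 h1]]]]]]]] [a2 [b2 [c2 [d2 [e2 [n2 [cop2 [det2 h2]]]]]]]].
exists (a1 * a2 + b1 * c2), (a1 * b2 + b1 * d2), (c1 * a2 + d1 * c2), (c1 * b2 + d1 * d2), (e1 * e2).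
split; first by rewrite mulf_neq0.
split; first by rewrite coprimezMl cop1 cop2.
split; first by rewrite exprMn -det1 -det2; ring.
move=> x y; rewrite exprMn -mulrA h2 h1; congr evalf; ring.
Qed.

Lemma same_genus_sym D f g : same_genus D f g -> same_genus D g f.
Proof.
move=> [a1 [b1 [c1 [d1 [e1 [n1 [cop1 [det1 h1]]]]]]]].
exists d1, (- b1), (- c1), a1, e1; split=> //; split=> //; split; first by rewrite -det1; ring.
move=> x y; apply: (mulfI (expf_neq0 2 n1)); rewrite h1.
have -> : a1 * (d1 * x + - b1 * y) + b1 * (- c1 * x + a1 * y) = e1 ^+ 2 * x by rewrite -det1; ring.
have -> : c1 * (d1 * x + - b1 * y) + d1 * (- c1 * x + a1 * y) = e1 ^+ 2 * y by rewrite -det1; ring.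
rewrite /evalf; ring.
Qed.

Lemma same_genus_sl2 D f g : sl2_equiv f g -> same_genus D f g.
Proof.
move=> [a1 [b1 [c1 [d1 [det1 h1]]]]]; exists a1, b1, c1, d1, 1.
split=> //; split; first by rewrite /coprimez /gcdz /= gcd1n.
by split; rewrite ?expr1n // => x y; rewrite mul1r.
Qed.

Lemma sl2_equiv_refl f : sl2_equiv f f.
Proof. by exists 1, 0, 0, 1; split=> // x y; rewrite !mul1r !mul0r addr0 add0r. Qed.

(** * Congruences modulo [8] and at the primes dividing [2 * D] *)

Lemma odd_sq (x : int) : ~~ (2%:Z %| x)%Z -> exists k, x ^+ 2 = 8 * k + 1.
Proof.
move=> /dvd2_odd [k ->]; have /dvdzP [m hm] := dvd2_mulS k; exists m.
transitivity (4 * (k * (k + 1)) + 1); first by ring.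
by rewrite hm; ring.
Qed.

Lemma coprimez_mod1 (x m : int) : (m %| x - 1)%Z -> coprimez x m.
Proof.
move=> /dvdzP [k e]; apply/coprimezP; exists (1, - k) => /=.
by rewrite mul1r mulNr -e; ring.
Qed.

Definition prime_to_part (p n : nat) : nat := partn n p^'.

(** The condition splits into one at [p] and one at the part of [2 * D] prime to [p], which are
    arranged separately. *)
Lemma coprimez_2D (p : nat) (d D : int)  : prime p -> D != 0 ->
  ~~ (p%:Z %| d)%Z -> coprimez d (prime_to_part p `|2 * D|)%:Z -> coprimez d (2 * (D * p%:Z ^+ 2)).
Proof.
move=> pp D0; rewrite -coprimez_prime // coprimez_sym => h1 h2.
rewrite mulrA coprimezMr; apply/andP; split; last by apply: coprimezXr.
move: h1 h2; rewrite !coprimezE !absz_nat.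
rewrite /prime_to_part -{2}(@partnC p `|2 * D|) ?absz_gt0 ?mulf_neq0 // coprimeMr => h1 ->.
by rewrite andbT p_part coprimeXr.
Qed.

(** * Exchanging the sublattices spanned by [(p v, w)] and [(v, p w)] within a genus *)

Section Genus.
Variables (p : nat) (pp : prime p).

(* Multiplication by [p * al + om * Omega] maps one lattice into the other one;
   its norm is [d ^ 2]. *)
Lemma same_genus_norm (A B C al om d D : int) :
  d != 0 -> coprimez d (2 * D) ->
  d ^+ 2 = (p%:Z * al) ^+ 2 + B * (p%:Z * al) * om + A * C * om ^+ 2 ->
  same_genus D (A * p%:Z ^+ 2, B * p%:Z, C) (A, B * p%:Z, C * p%:Z ^+ 2).
Proof.
move=> d0 cop e.
exists al, (- (C * om)), (A * om), (p%:Z * (p%:Z * al + B * om)), d.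
split=> //; split=> //; split; first by rewrite e; ring.
by move=> x y; rewrite e /evalf /fa /fb /fc /=; ring.
Qed.

(** With [beta = s + t * Omega], the hypotheses say that [beta ^ 2] is [k * (p * al + om * Omega)]
    and that [beta] has norm [k * d]; the map divided by [d] is therefore [beta / conj beta]. The
    factor [k] is a common divisor removed to make [d] prime to [p]. *)
Lemma same_genus_swap_core (A B C al om d k s t : int) (D := B ^+ 2 - 4 * A * C) :
  D != 0 -> k != 0 ->
  k * p%:Z * al = s ^+ 2 - A * C * t ^+ 2 -> k * om = t * (2 * s + B * t) ->
  k * d = s ^+ 2 + B * s * t + A * C * t ^+ 2 ->
  ~~ (p%:Z %| d)%Z -> ((prime_to_part p `|2 * D|)%:Z %| s - 1)%Z -> ((prime_to_part p `|2 * D|)%:Z %| t)%Z ->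
  same_genus (D * p%:Z ^+ 2) (A * p%:Z ^+ 2, B * p%:Z, C) (A, B * p%:Z, C * p%:Z ^+ 2).
Proof.
move=> D0 k0 eal eom ed hd hs ht.
apply: (@same_genus_norm A B C al om d).
- by apply: contraNneq hd => ->; rewrite dvdz0.
- apply: (coprimez_2D pp D0 hd).
  (* Away from [p], [beta] is congruent to [1], hence so is its norm [k * d]. *)
  have : coprimez (k * d) (prime_to_part p `|2 * D|)%:Z.
    apply: coprimez_mod1; rewrite ed.
    have -> : s ^+ 2 + B * s * t + A * C * t ^+ 2 - 1 =
      (s - 1) * (s + 1) + t * (B * s + A * C * t) by ring.
    by apply: rpredD; apply: dvdz_mulr.
  by rewrite coprimezMl => /andP[].
apply: (mulfI (expf_neq0 2 k0)); rewrite -exprMn ed.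
transitivity ((k * p%:Z * al) ^+ 2 + B * (k * p%:Z * al) * (k * om) + A * C * (k * om) ^+ 2).
  by rewrite eal eom; ring.
by ring.
Qed.

(** With this [e], the number [1 + e * (x - 1)] is [x] modulo [p ^ 2] and [1] modulo the part of [n]
    prime to [p]. *)
Lemma crt_idem (n : nat) : (0 < n)%N ->
  exists e : int, (p%:Z ^+ 2 %| e - 1)%Z /\ ((prime_to_part p n)%:Z %| e)%Z.
Proof.
move=> n0.
have : coprimez ((prime_to_part p n)%:Z) (p%:Z ^+ 2).
  apply: coprimezXr; rewrite coprimezE !absz_nat coprime_sym prime_coprime //.
  apply/negP => h; have := part_pnat p^' n.
  by move/pnatP => /(_ (part_gt0 _ _)) /(_ _ pp h); rewrite !inE eqxx.
move=> /coprimezP [[u v] /= e]; exists (u * (prime_to_part p n)%:Z); split; last exact: dvdz_mull.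
by apply/dvdzP; exists (- v); rewrite -e; ring.
Qed.

Lemma same_genus_swap_odd (A B C : int) (D := B ^+ 2 - 4 * A * C) : p != 2%N -> D != 0 ->
  ~~ (p%:Z %| A * C)%Z -> (exists y, (p%:Z %| y ^+ 2 - A * C)%Z) ->
  same_genus (D * p%:Z ^+ 2) (A * p%:Z ^+ 2, B * p%:Z, C) (A, B * p%:Z, C * p%:Z ^+ 2).
Proof.
move=> p2 D0 hAC [tau0 htau0].
have h2 : ~~ (p%:Z %| 2)%Z.
  apply: contra p2; rewrite dvdzE absz_nat => h; rewrite eq_sym -dvdn_prime2 //.
  by rewrite dvdn_prime2 // in h; rewrite dvdn_prime2 // eq_sym.
(* The norm of [tau + Omega] is [tau * (2 * tau + B)] modulo [p]. The two signs of the root cannot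
   both make it vanish, since then [p] would divide [4 * tau0]. *)
have [tau htau ntau] : exists2 tau, (p%:Z %| tau ^+ 2 - A * C)%Z & ~~ (p%:Z %| tau * (2 * tau + B))%Z.
  have nt0 : ~~ (p%:Z %| tau0)%Z.
    apply: contra hAC => h; rewrite -[A * C](subKr (tau0 ^+ 2)).
    by apply: rpredB => //; rewrite expr2; apply: dvdz_mulr.
  case: (boolP (p%:Z %| 2 * tau0 + B)%Z) => h; last first.
    by exists tau0 => //; rewrite Euclid_dvdzM // negb_or nt0.
  exists (- tau0); rewrite ?sqrrN // Euclid_dvdzM // negb_or rpredN nt0 /=.
  apply: contra nt0 => h'.
  have : (p%:Z %| (2 * 2) * tau0)%Z.
    have -> : (2 * 2) * tau0 = (2 * tau0 + B) - (2 * (- tau0) + B) by ring.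
    exact: rpredB.
  by rewrite !Euclid_dvdzM // (negbTE h2).
have [e [/dvdzP [e' he1] he2]] := @crt_idem `|2 * D| ltac:(by rewrite absz_gt0 mulf_neq0).
have ee : e = 1 + p%:Z * (e' * p%:Z) by rewrite -[e](subrK 1) he1; ring.
pose j := e' * p%:Z.
(* Here [beta = s + e * Omega] is [tau + Omega] modulo [p] and [1] at the other primes of
   [2 * D]. *)
pose s := 1 + e * (tau - 1).
have es : s = tau + p%:Z * (j * (tau - 1)) by rewrite /s ee /j; ring.
have : (p%:Z %| s ^+ 2 - A * C * e ^+ 2)%Z.
  have -> : s ^+ 2 - A * C * e ^+ 2 = (tau ^+ 2 - A * C) +
    p%:Z * (j * (tau - 1) * (2 * tau + p%:Z * (j * (tau - 1))) - A * C * (j * (2 + p%:Z * j))).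
    by rewrite es ee /j; ring.
  by apply: rpredD => //; apply: dvdz_mulr.
move=> /dvdzP [al hal].
apply: (@same_genus_swap_core A B C al (e * (2 * s + B * e)) (s ^+ 2 + B * s * e + A * C * e ^+ 2) 1 s e) => //.
- by rewrite mul1r mulrC hal.
- by rewrite mul1r.
- by rewrite mul1r.
- apply: contra ntau => h.
  have -> : tau * (2 * tau + B) = (s ^+ 2 + B * s * e + A * C * e ^+ 2)
    - (s ^+ 2 - A * C * e ^+ 2) + 2 * (tau ^+ 2 - A * C) - B * (s * e - tau) - 2 * A * C * (e ^+ 2 - 1).
    by ring.
  have d1 : (p%:Z %| e - 1)%Z by rewrite ee addrC addKr dvdz_mulr.
  apply: rpredB; [apply: rpredB; [apply: rpredD; [apply: rpredB => //|]|]|].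
  + by rewrite hal dvdz_mull.
  + by apply: dvdz_mull.
  + apply: dvdz_mull; have -> : s * e - tau = (e - 1) * ((tau - 1) * e + tau) by rewrite /s; ring.
    exact: dvdz_mulr.
  + by apply: dvdz_mull; rewrite subr_sqr_1; apply: dvdz_mulr.
by rewrite /s addrC addKr dvdz_mulr.
Qed.

End Genus.

(** At [2], [beta] is close to [sg + Omega] and its norm must be [k] times an odd number. If [B] is
    odd, [sg = 1] and [k = 1]. If [B = 2 * b] with [b] even, [sg = 1] and [k = 2]. If [b] is odd,
    [sg = b] and [k = 4]. *)
Lemma same_genus_swap_even (A B C : int) (D := B ^+ 2 - 4 * A * C) : D != 0 ->
  ~~ (2%:Z %| A * C)%Z -> (exists y, ((qmod 2 D)%:Z %| y ^+ 2 - A * C)%Z) ->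
  same_genus (D * 2%:Z ^+ 2) (A * 2%:Z ^+ 2, B * 2%:Z, C) (A, B * 2%:Z, C * 2%:Z ^+ 2).
Proof.
move=> D0 hAC [y hy].
have [e [/dvdzP [j he1] he2]] := @crt_idem 2 isT `|2 * D| ltac:(by rewrite absz_gt0 mulf_neq0).
have ee : e = 4 * j + 1 by lia.
have [T eT] : exists T, e ^+ 2 = 8 * T + 1 by apply: odd_sq; lia.
have swap sg al om d k (s := 1 + e * (sg - 1)) : k != 0 ->
    k * 2%:Z * al = s ^+ 2 - A * C * e ^+ 2 -> k * om = e * (2 * s + B * e) ->
    k * d = s ^+ 2 + B * s * e + A * C * e ^+ 2 -> ~~ (2%:Z %| d)%Z ->
    same_genus (D * 2%:Z ^+ 2) (A * 2%:Z ^+ 2, B * 2%:Z, C) (A, B * 2%:Z, C * 2%:Z ^+ 2).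
  move=> k0 h1 h2 h3 h4.
  apply: (@same_genus_swap_core 2 isT A B C al om d k s e D0 k0 h1 h2 h3 h4) => //.
  by rewrite /s addrC addKr dvdz_mulr.
have [K eK] := dvd2_odd hAC.
case: (boolP (2%:Z %| B)%Z) => [/dvdzP [b eB]|/dvd2_odd [b eB]]; last first.
  pose N := 1 + B * e + A * C * e ^+ 2.
  apply: (@swap 1 (- (4 * T + K + 8 * K * T)) (e * (2 + B * e)) N 1) => //.
  - by rewrite subrr mulr0 addr0 eT eK; ring.
  - by rewrite subrr mulr0 addr0 mulr1 mul1r.
  - by rewrite subrr mulr0 addr0 mul1r /N; ring.
  - rewrite /N eB eK eT ee.
    have -> : 1 + (2 * b + 1) * (4 * j + 1) + (2 * K + 1) * (8 * T + 1)
      = 2 * (1 + b + 4 * b * j + 2 * j + 8 * K * T + K + 4 * T) + 1 by ring.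
    by lia.
have eD : D = 4 * (b ^+ 2 - A * C) by rewrite /D eB; ring.
have q4 : (4 %| (qmod 2 D)%:Z)%Z.
  rewrite /qmod /= /t2; case: ifP => // _; case: ifP => //.
  by move=> /negP []; rewrite eD; apply/dvdzP; exists (2 * (b ^+ 2 - A * C)); ring.
have yodd : ~~ (2%:Z %| y)%Z.
  apply: contra hAC => hy2; rewrite -[A * C](subKr (y ^+ 2)); apply: rpredB.
    by rewrite expr2; apply: dvdz_mulr.
  by apply: dvdz_trans hy; apply: dvdz_trans q4.
have [Y eY] := odd_sq yodd.
have [K4 eK4] : exists K4, A * C = 4 * K4 + 1.
  have /dvdzP [l hl] := dvdz_trans q4 hy; exists (2 * Y - l); move: hl; rewrite eY; lia.
case: (boolP (2%:Z %| b)%Z) => [/dvdzP [b' eb]|bodd].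
  pose d := 4 * T + 1 + 2 * K4 + 16 * K4 * T + 2 * b' * e.
  apply: (@swap 1 (- (2 * T + K4 + 8 * K4 * T)) (e * (1 + b * e)) d 2) => //.
  - by rewrite subrr mulr0 addr0 eT eK4; ring.
  - by rewrite subrr mulr0 addr0 mulr1 eB; ring.
  - by rewrite subrr mulr0 addr0 eB eb eT eK4 /d; ring.
  - have -> : d = 2 * (2 * T + K4 + 8 * K4 * T + b' * e) + 1 by rewrite /d; ring.
    by lia.
have [Sb eSb] := odd_sq bodd.
(* Both [b ^ 2] and [A * C] are [1] modulo [4], so [16] divides [D]; the modulus is thus [8], which
   strengthens the congruence on [A * C]. *)
have D16 : (16 %| D)%Z.
  by apply/dvdzP; exists (2 * Sb - K4); rewrite eD eSb eK4; ring.
have {hy} : (8 %| y ^+ 2 - A * C)%Z by move: hy; rewrite /qmod /= /t2 D16.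
rewrite eY => /dvdzP [l hl].
have [K8 eK8] : exists K8, A * C = 8 * K8 + 1 by exists (Y - l); lia.
pose s := 1 + e * (b - 1); pose s1 := j * (b - 1).
have es : s = 4 * s1 + b by rewrite /s /s1 ee; ring.
have [S eS] : exists S, s ^+ 2 = 8 * S + 1.
  by apply: odd_sq; rewrite es; lia.
have [b1 eb1] := dvd2_odd bodd.
pose Q := b * s1 * 4 * j + b * s1 + b ^+ 2 * j.
have ebse : b * s * e = 4 * Q + 8 * Sb + 1.
  transitivity (4 * Q + b ^+ 2); first by rewrite es ee /Q; ring.
  by rewrite eSb; ring.
pose d := 2 * S + 2 * Q + 4 * Sb + 2 * K8 + 2 * T + 16 * K8 * T + 1.
apply: (@swap b (S - K8 - T - 8 * K8 * T) (e * (2 * s1 + b + 2 * b * j)) d 4) => //.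
- by rewrite -/s eS eT eK8; ring.
- by rewrite -/s es eB ee; ring.
- transitivity (s ^+ 2 + 2 * (b * s * e) + A * C * e ^+ 2); last by rewrite -/s eB; ring.
  by rewrite eS ebse eT eK8 /d; ring.
- have -> : d = 2 * (S + Q + 2 * Sb + K8 + T + 8 * K8 * T) + 1 by rewrite /d; ring.
  by lia.
Qed.

(** * The square class decides the genus *)

Section GenusPsi.
Variables (p : nat) (pp : prime p) (f : bqf) (df : posdef f).
Implicit Types i j : option 'I_p.

Lemma same_genus_swap (A B C : int) (D := B ^+ 2 - 4 * A * C) : D != 0 ->
  good p D 1 (A * C) ->
  same_genus (D * p%:Z ^+ 2) (A * p%:Z ^+ 2, B * p%:Z, C) (A, B * p%:Z, C * p%:Z ^+ 2).
Proof.
move=> D0 /andP[h1]; rewrite mul1r => /(sqmodP _ (qmod_gt0 pp D)).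
case: (eqVneq p 2%N) => [e|p2]; last by rewrite /qmod (negbTE p2); apply: same_genus_swap_odd.
by move: h1; rewrite e; apply: same_genus_swap_even.
Qed.

(** Complete [pvec j] to a basis by [w0], then add a multiple of [pvec j] to reach the lattice of
    [i]; this works because [det2 (pvec i) (pvec j)] is invertible modulo [p]. *)
Lemma pvec_complement i j : i != j -> exists w, det2 (pvec j) w = 1 /\ inlat i w.
Proof.
move=> ij.
pose w0 : ivec := if j is Some _ then (-1, 0) else (0, 1).
have d0 : det2 (pvec j) w0 = 1 by rewrite /w0; case: (j) => [h|] /=; rewrite /det2 /=; ring.
have hd : ~~ (p%:Z %| det2 (pvec i) (pvec j))%Z.
  apply: contra ij => h; apply/eqP.
  exact: (inlat_uniq pp (pdiv2_pvec pp j) h (inlat_pvec j)).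
have [m hm] := prime_inv pp hd.
exists (comb 1 (- m * det2 (pvec i) w0) w0 (pvec j)); split.
  by rewrite -[RHS]d0 /det2 /comb /=; ring.
rewrite /inlat (_ : det2 _ _ = - det2 (pvec i) w0 * (det2 (pvec i) (pvec j) * m - 1)).
  exact: dvdz_mull.
by rewrite /det2 /comb /=; ring.
Qed.

Lemma disc_neq0 : disc f != 0. Proof. by case/andP: df => _ h; rewrite lt_eqF. Qed.

Lemma same_genus_psi r i j : ~~ (p%:Z %| r)%Z ->
  good p (disc f) r (qev f (pvec i)) -> good p (disc f) r (qev f (pvec j)) ->
  same_genus (disc f * p%:Z ^+ 2) (psi f i) (psi f j).
Proof.
move=> hr; case: (eqVneq i j) => [<- _ _|ij gi gj].
  exact: same_genus_sl2 (sl2_equiv_refl _).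
have [w [dw iw]] := pvec_complement ij.
have nw : ~~ pdiv2 p w.
  apply/negP => /andP [h1 h2].
  have : (p%:Z %| det2 (pvec j) w)%Z by apply: rpredB; apply: dvdz_mull.
  by rewrite dw dvdz1 absz_nat gtn_eqF // prime_gt1.
have gw : good p (disc f) r (qev f w) by rewrite (good_inlat pp f r iw nw).
(* In the basis [(pvec j, w)] the form is [(A, B, C)], while the lattices of [j] and [i] are spanned
   by [(pvec j, p w)] and [(p pvec j, w)]. *)
pose A := qev f (pvec j); pose B := bil f (pvec j) w; pose C := qev f w.
have eD : B ^+ 2 - 4 * A * C = disc f by rewrite bil_disc dw expr1n mulr1.
have e1 : sl2_equiv (psi f j) (A, B * p%:Z, C * p%:Z ^+ 2).
  apply: (@sl2_equiv_basis p pp f j _ (pvec j) (comb p%:Z 0 w w)).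
  - exact: inlat_pvec.
  - by apply: pdiv2_inlat; rewrite /pdiv2 /comb /= !mul0r !addr0 !dvdz_mulr.
  - by rewrite -[RHS]mulr1 -dw /det2 /comb /=; ring.
  - by move=> x y; rewrite /A /B /C /qev /evalf /bil /comb /fa /fb /fc /=; ring.
have e2 : sl2_equiv (psi f i) (A * p%:Z ^+ 2, B * p%:Z, C).
  apply: (@sl2_equiv_basis p pp f i _ (comb p%:Z 0 (pvec j) w) w) => //.
  - by apply: pdiv2_inlat; rewrite /pdiv2 /comb /= !mul0r !addr0 !dvdz_mulr.
  - by rewrite -[RHS]mulr1 -dw /det2 /comb /=; ring.
  - by move=> x y; rewrite /A /B /C /qev /evalf /bil /comb /fa /fb /fc /=; ring.
apply: same_genus_trans (same_genus_sl2 _ e2) _.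
apply: same_genus_trans _ (same_genus_sym (same_genus_sl2 _ e1)).
rewrite -eD; apply: same_genus_swap; rewrite eD ?disc_neq0 //.
(* Since [r * A] and [r * C] are squares modulo [qmod], so is [r ^ 2 * (A * C)]. *)
rewrite -(good_mulsq pp _ _ _ hr).
move: gj gw => /andP[h1 /(sqmodP _ (qmod_gt0 pp _)) [y1 hy1]] /andP[h2 /(sqmodP _ (qmod_gt0 pp _)) [y2 hy2]].
rewrite -/A in h1; rewrite -/C in h2.
rewrite /good expr2 !Euclid_dvdzM // !negb_or hr h1 h2 /=.
apply/(sqmodP _ (qmod_gt0 pp _)); exists (y1 * y2).
rewrite (_ : _ - _ = (y1 ^+ 2 - r * A) * y2 ^+ 2 + r * A * (y2 ^+ 2 - r * C)); last by ring.
by apply: rpredD; [apply: dvdz_mulr|apply: dvdz_mull].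
Qed.

Lemma qev_pvec i :
  qev f (pvec i) = if i is Some _ then fc (psi f i) else fa (psi f i).
Proof. by case: i => [h|]; rewrite /qev /evalf /fa /fb /fc /=; ring. Qed.

(** Primitivity makes the value at [pvec j] prime to [p], as the other two coefficients of [psi f j]
    are multiples of [p]. The genus equivalence turns [d ^ 2] times this value into a value on the
    lattice of [i], to which [good_inlat] applies. *)
Lemma good_same_genus r i j : primitive (psi f j) ->
  good p (disc f) r (qev f (pvec i)) ->
  same_genus (disc f * p%:Z ^+ 2) (psi f i) (psi f j) ->
  good p (disc f) r (qev f (pvec j)).
Proof.
move=> pj gi [al [be [ga [de [d [d0 [cop [hdet h]]]]]]]].
have hd : ~~ (p%:Z %| d)%Z.
  rewrite -coprimez_prime // coprimez_sym; move: cop; rewrite !coprimezMr => /and3P[_ _].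
  by case/andP.
have [[x y] ez] := inlatP pp (inlat_pvec j).
have hv : ~~ (p%:Z %| qev f (pvec j))%Z.
  apply/negP => hv; have : (p%:Z %| 1)%Z.
    move: hv; rewrite qev_pvec => hv.
    apply: (primitive_dvd pj); rewrite mulr1; case: (j) hv => [k|] //= _.
    + by apply: dvdz_mull; apply: dvdz_mulr.
    + exact: dvdz_mulr.
    + exact: dvdz_mull.
    + by apply: dvdz_mull; apply: dvdz_mulr.
  by rewrite dvdz1 absz_nat gtn_eqF // prime_gt1.
have := h x y; rewrite !evalf_psi -ez => hh.
rewrite -(good_mulsq pp _ _ _ hd) hh (good_inlat pp f r (inlat_latmap i _)) //.
by apply: (@qev_pdiv2 p f); rewrite -hh Euclid_dvdzM // negb_or hv Euclid_dvdzM // negb_or hd.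
Qed.

Lemma prime_dvd_exists (n : nat) : (n != 1)%N -> exists2 l, prime l & (l %| n)%N.
Proof.
by move=> n1; case: n n1 => [|[|n]] // _; [exists 2%N|exists (pdiv n.+2); rewrite ?pdiv_prime ?pdiv_dvd].
Qed.

Lemma primitive_psi j : primitive f -> ~~ (p%:Z %| qev f (pvec j))%Z -> primitive (psi f j).
Proof.
move=> pf hj; apply/negPn/negP => h.
have [] := @prime_dvd_exists `|gcdz (gcdz (fa (psi f j)) (fb (psi f j))) (fc (psi f j))|.
  by move: h; rewrite /primitive -eqz_nat gez0_abs.
move=> l pl; rewrite -[(_ %| _)%N]/(l%:Z %| (_ : int))%Z !dvdz_gcd -andbA => /and3P[ha hb hc].
(* A common prime factor [l] differs from [p], so it can be cancelled against [p] and divides all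
   coefficients of [f]. *)
have lp : ~~ (l%:Z %| p%:Z)%Z.
  apply: contra hj; rewrite dvdzE !absz_nat dvdn_prime2 // => /eqP e.
  suff : (l%:Z %| qev f (pvec j))%Z by rewrite e.
  by rewrite qev_pvec; case: (j) ha hc.
have : (l%:Z %| 1)%Z.
  move: ha hb hc; case: (j) => [k|]; rewrite /fa /fb /fc /= !Euclid_dvdzM // !(negbTE lp) ?orbF /= => ha hb hc.
    have hb' : (l%:Z %| fb f)%Z.
      move: hb; rewrite rpredDr // -mulrA; apply: dvdz_mull; exact: dvdz_mulr.
    apply: (primitive_dvd pf); rewrite mulr1 //.
    by move: hc; rewrite rpredDl //; apply: rpredD; apply: dvdz_mulr.
  by apply: (primitive_dvd pf); rewrite mulr1.
by rewrite dvdz1 absz_nat gtn_eqF // prime_gt1.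
Qed.

End GenusPsi.

(** * Counting representations *)

Definition box (N : nat) : seq ivec :=
  [seq (i%:Z - N%:Z, j%:Z - N%:Z) | i <- iota 0 (N + N).+1, j <- iota 0 (N + N).+1].

Definition sols (f : bqf) (n : nat) : seq ivec :=
  [seq z <- box (rep_bound f n) | qev f z == n%:Z].

Lemma mem_box N (x y : int) : ((x, y) \in box N) = (`|x| <= N)%N && (`|y| <= N)%N.
Proof.
apply/allpairsP/andP => [[[i j] [hi hj [-> ->]]]|[hx hy]].
  by move: hi hj; rewrite !mem_iota /=; lia.
exists (absz (x + N%:Z), absz (y + N%:Z)); rewrite !mem_iota /=; split; try lia.
by congr pair; lia.
Qed.

Lemma uniq_sols f n : uniq (sols f n).
Proof.
apply: filter_uniq; apply: allpairs_uniq; rewrite ?iota_uniq //.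
by move=> [i j] [i' j'] /= _ _ [] h1 h2; congr pair; lia.
Qed.

Lemma mem_sols f n z : posdef f -> (z \in sols f n) = (qev f z == n%:Z).
Proof.
move=> df; rewrite mem_filter; case: eqP => //= e; case: z e => x y e.
by rewrite mem_box; have [-> ->] := rep_box_complete df e.
Qed.

Lemma rep_sols f n : rep f n = size (sols f n).
Proof.
have sumI K (F : nat -> nat) : (\sum_(i <- iota 0 K) F i = \sum_(i < K) F i)%N.
  by rewrite -(big_mkord xpredT) /index_iota subn0.
rewrite size_filter -sum1_count big_mkcond big_allpairs_dep /rep sumI.
by apply: eq_bigr => i _; rewrite sumI; apply: eq_bigr => j _; rewrite /qev /=; case: eqP.
Qed.

(** The map [phi] is a bijection onto the vectors satisfying [P] and multiplies values by [k]. It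
    serves for proper equivalences, for [latmap] and for multiplication by [p]. *)
Lemma rep_count f g k n (P : pred ivec) (phi : ivec -> ivec) :
  posdef f -> posdef g -> (0 < k)%N -> injective phi ->
  (forall z, qev f (phi z) = k%:Z * qev g z) ->
  (forall z, P (phi z)) -> (forall z, P z -> exists z', z = phi z') ->
  rep g n = count P (sols f (k * n)).
Proof.
move=> df dg k0 injphi hphi hP hS; rewrite rep_sols -(size_map phi) -size_filter.
have kz : k%:Z != 0 by rewrite eqz_nat -lt0n.
apply/perm_size/uniq_perm => [||z]; first by rewrite map_inj_uniq ?uniq_sols.
  exact/filter_uniq/uniq_sols.
rewrite mem_filter mem_sols //; apply/mapP/andP => [[z' + ->]|[/hS [z' ->]]].
  by rewrite mem_sols // => /eqP e; rewrite hP hphi e PoszM.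
by rewrite hphi PoszM => /eqP /(mulfI kz) /eqP e; exists z'; rewrite ?mem_sols.
Qed.

Lemma sl2_equiv_sym f g : sl2_equiv f g -> sl2_equiv g f.
Proof.
move=> [a [b [c [d [e h]]]]]; exists d, (- b), (- c), a; split; first by rewrite -e; ring.
move=> x y; rewrite h; congr evalf.
  by rewrite -[LHS]mul1r -e; ring.
by rewrite -[LHS]mul1r -e; ring.
Qed.

Lemma sl2_equiv_trans f g h : sl2_equiv f g -> sl2_equiv g h -> sl2_equiv f h.
Proof.
move=> [a [b [c [d [e h1]]]]] [a' [b' [c' [d' [e' h2]]]]].
exists (a * a' + b * c'), (a * b' + b * d'), (c * a' + d * c'), (c * b' + d * d'); split.
  by rewrite -[RHS]mulr1 -{1}e -e'; ring.
by move=> x y; rewrite h2 h1; congr evalf; ring.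
Qed.

Lemma rep_sl2 f g n : posdef f -> posdef g -> sl2_equiv f g -> rep f n = rep g n.
Proof.
move=> df dg [a [b [c [d [e h]]]]]; pose phi (z : ivec) : ivec := (a * z.1 + b * z.2, c * z.1 + d * z.2).
pose psi' (z : ivec) : ivec := (d * z.1 - b * z.2, a * z.2 - c * z.1).
have phiK : cancel phi psi'.
  move=> [x y]; rewrite /phi /psi' /=; congr pair.
    by rewrite -[RHS]mul1r -e; ring.
  by rewrite -[RHS]mul1r -e; ring.
have psiK : cancel psi' phi.
  move=> [x y]; rewrite /phi /psi' /=; congr pair.
    by rewrite -[RHS]mul1r -e; ring.
  by rewrite -[RHS]mul1r -e; ring.
rewrite (@rep_count f g 1 n predT phi) //; first by rewrite mul1n count_predT -rep_sols.
- exact: can_inj phiK.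
- by move=> [x y]; rewrite mul1r /qev h.
- by move=> z _; exists (psi' z); rewrite psiK.
Qed.

(** * Double counting of vectors and lattices *)

Section Count.
Variables (p : nat) (pp : prime p) (f : bqf) (df : posdef f) (pf : primitive f).
Implicit Types i j : option 'I_p.

Lemma rep_psi i n : rep (psi f i) n = count (inlat i) (sols f n).
Proof.
rewrite (@rep_count f (psi f i) 1 n (inlat i) (@latmap p i)) ?mul1n //.
- exact: posdef_psi.
- exact: latmap_inj.
- by move=> z; rewrite mul1r qev_psi.
- exact: inlat_latmap.
- by move=> z /(inlatP pp).
Qed.

Lemma theta_count n : theta_pow f (p ^ 2) n = count (pdiv2 p) (sols f n).
Proof.
have p0 := p_neq0 pp.
rewrite /theta_pow; case: ifP => hn.
  rewrite (@rep_count f f (p ^ 2) _ (pdiv2 p) (fun z => (p%:Z * z.1, p%:Z * z.2))) //.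
  - by rewrite mulnC divnK.
  - by rewrite expn_gt0 prime_gt0.
  - by move=> [x y] [x' y'] /= [] /(mulfI p0) -> /(mulfI p0) ->.
  - by move=> z; rewrite /qev /evalf /= -mulnn PoszM; ring.
  - by move=> z; rewrite /pdiv2 /= !dvdz_mulr.
  - move=> [x y] /andP[/= /dvdzP [x' ->] /dvdzP [y' ->]]; exists (x', y') => /=.
    by congr pair; ring.
apply/esym/eqP; rewrite eqn0Ngt -has_count; apply/hasP => [] [[x y]].
rewrite mem_sols // => /eqP e /andP[/= /dvdzP [x' ex] /dvdzP [y' ey]].
move/negP: hn; apply; rewrite -[(_ %| _)%N]/((p ^ 2)%N%:Z %| n%:Z)%Z -e.
by apply/dvdzP; exists (qev f (x', y')); rewrite /qev /evalf /= ex ey -mulnn PoszM; ring.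
Qed.

Lemma sum_rep_psi r n :
  (\sum_(i : option 'I_p | good p (disc f) r (qev f (pvec i))) rep (psi f i) n =
   #|[pred i : option 'I_p | good p (disc f) r (qev f (pvec i))]| * theta_pow f (p ^ 2) n
   + good p (disc f) r n%:Z * rep f n)%N.
Proof.
pose S i := good p (disc f) r (qev f (@pvec p i)).
transitivity (\sum_(z <- sols f n) \sum_(i | S i) inlat i z)%N.
  rewrite exchange_big /=; apply: eq_bigr => i _; rewrite rep_psi -sum1_count big_mkcond /=.
  by apply: eq_bigr => z _; case: (inlat i z).
(* A vector of [pZ^2] lies in all selected lattices and makes [n] divisible by [p], hence not good.
   Any other vector lies in one lattice, which is selected exactly when [n] is good. *)
transitivity (\sum_(z <- sols f n) (#|[pred i | S i]| * pdiv2 p z + good p (disc f) r n%:Z))%N.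
  apply: eq_big_seq => z; rewrite mem_sols // => /eqP ez.
  case: (boolP (pdiv2 p z)) => hz.
    have -> : good p (disc f) r n%:Z = false.
      apply/negbTE; rewrite /good negb_and negbK; apply/orP; left; rewrite -ez.
      by apply/negPn/negP => /(@qev_pdiv2 p f); rewrite hz.
    rewrite addn0 muln1 -sum1_card; apply: eq_bigr => i _; by rewrite pdiv2_inlat.
  have [i0 hi0] := inlat_exists pp z.
  rewrite muln0 add0n -ez (good_inlat pp f r hi0 hz) -/(S i0) big_mkcond (bigD1 i0) //= hi0 big1.
    by rewrite addn0; case: (S i0).
  move=> i ni; case: ifP => // _; case: (boolP (inlat i z)) => // hi.
  by rewrite (inlat_uniq pp hz hi hi0) eqxx in ni.
rewrite big_split /= -big_distrr /=; congr addn.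
  by rewrite theta_count -sum1_count [in RHS]big_mkcond; congr muln; apply: eq_bigr => z _; case: pdiv2.
by rewrite big_const_seq count_predT iter_addn_0 rep_sols.
Qed.

Lemma psieqv_good r i j : good p (disc f) r (qev f (pvec j)) -> psieqv f i j ->
  good p (disc f) r (qev f (pvec i)).
Proof.
move=> gj /hasP [u hu hin].
have e : qev f (umul f u (pvec j)) = qev f (pvec j) by rewrite qev_umul nrm_units // mul1r.
have nz : ~~ pdiv2 p (umul f u (pvec j)).
  by apply: (@qev_pdiv2 p f); rewrite e; case/andP: gj.
by rewrite -(good_inlat pp f r hin nz) e.
Qed.

(** Every class accounts for [wD] lattices by [card_psieqv]. The function [F] is left general so
    that the lemma also counts the lattices, with [F] constant. *)
Lemma sum_classes r (g0 : bqf) (R : seq bqf) (F : bqf -> nat) :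
  (forall i j, sl2_equiv (psi f i) (psi f j) -> F (psi f i) = F (psi f j)) ->
  (forall g, g \in R -> exists2 j, g = psi f j & good p (disc f) r (qev f (@pvec p j))) ->
  (forall m n, (m < size R)%N -> (n < size R)%N ->
     sl2_equiv (nth g0 R m) (nth g0 R n) -> m = n) ->
  (forall i, good p (disc f) r (qev f (@pvec p i)) ->
     exists2 h, h \in R & sl2_equiv (psi f i) h) ->
  (\sum_(i : option 'I_p | good p (disc f) r (qev f (pvec i))) F (psi f i) =
   wD (disc f) * \sum_(g <- R) F g)%N.
Proof.
move=> hF hR hinj hS.
pose S i := good p (disc f) r (qev f (@pvec p i)).
pose idx g := odflt None [pick j : option 'I_p | (psi f j == g) && S j].
have idxP g : g \in R -> psi f (idx g) = g /\ S (idx g).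
  move=> /hR [j -> sj]; rewrite /idx; case: pickP => [k /andP[/eqP -> ->] //|].
  by move/(_ j); rewrite eqxx [S j]sj.
have ndvd j : S j -> ~~ (p%:Z %| qev f (pvec j))%Z by case/andP.
have eqvP i g : g \in R -> reflect (sl2_equiv (psi f i) g) (psieqv f i (idx g)).
  by move=> /idxP [e s]; rewrite -{1}e; apply: psieqvP => //; apply: ndvd.
have injR g h : g \in R -> h \in R -> sl2_equiv g h -> g = h.
  move=> hg hh hgh.
  have e : index g R = index h R by apply: hinj; rewrite ?index_mem ?nth_index.
  by rewrite -(nth_index g0 hg) e nth_index.
have uR : uniq R.
  apply/(uniqP g0) => i j hi hj e; apply: hinj => //; rewrite e; exact: sl2_equiv_refl.
(* Exactly one representative in [R] is equivalent to a given [psi f i], so the inner sum has a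
   single term. *)
transitivity (\sum_(i | S i) \sum_(g <- R) psieqv f i (idx g) * F g)%N.
  apply: eq_bigr => i si; have [h hh hih] := hS i si.
  rewrite (bigD1_seq h) //= (introT (eqvP i h hh) hih) mul1n big_seq_cond big1.
    have [e _] := idxP h hh; rewrite addn0 -e; apply: hF; by rewrite e.
  move=> g /andP[hg /eqP ng]; case: (eqvP i g hg) => // hig; case: ng.
  by apply: injR => //; apply: sl2_equiv_trans (sl2_equiv_sym hig) hih.
rewrite exchange_big /= big_distrr /= [LHS]big_seq [RHS]big_seq; apply: eq_bigr => g hg.
rewrite -big_distrl /=; congr muln; have [_ sg] := idxP g hg.
rewrite -(card_psieqv pp pf df (ndvd _ sg)) -sum1_card big_mkcond [RHS]big_mkcond /=.
apply: eq_bigr => i _; rewrite !inE; case: (boolP (psieqv f i (idx g))) => h.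
  by rewrite /S (psieqv_good sg h).
by case: ifP.
Qed.

End Count.

(** * The square class condition as Legendre symbols and as residues *)

Lemma good_odd (p : nat) (D : int) (r n : nat) (N : rat) : prime p -> p != 2%N ->
  ~~ (p%:Z %| r%:Z)%Z ->
  \sum_(1 <= i < p) ((legendre (r%:Z * i%:Z) p)%:~R + 1) / 2 *
     (if (n %% p == i)%N then N else 0) = (good p D r%:Z n%:Z)%:R * N.
Proof.
move=> pp p2 hr; rewrite /good /qmod (negbTE p2) -[(p%:Z %| n%:Z)%Z]/(p %| n)%N /dvdn.
have hq : sqmod p (r%:Z * n%:Z) = sqmod p (r%:Z * (n %% p)%N%:Z).
  have hc : (p%:Z %| n%:Z - (n %% p)%N%:Z)%Z.
    by apply/dvdzP; exists (n %/ p)%N%:Z; rewrite {1}(divn_eq n p) PoszD PoszM addrK.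
  apply/(sqmodP _ (prime_gt0 pp))/(sqmodP _ (prime_gt0 pp)) => [] [y hy]; exists y.
    rewrite (_ : _ - _ = y ^+ 2 - r%:Z * n%:Z + r%:Z * (n%:Z - (n %% p)%N%:Z)); last by ring.
    by apply: rpredD => //; apply: dvdz_mull.
  rewrite (_ : _ - _ = y ^+ 2 - r%:Z * (n %% p)%N%:Z - r%:Z * (n%:Z - (n %% p)%N%:Z)); last by ring.
  by apply: rpredB => //; apply: dvdz_mull.
case: (eqVneq (n %% p)%N 0%N) => [->|h0] /=.
  rewrite mul0r big_nat big1 // => i /andP[i0 _].
  by rewrite eq_sym gtn_eqF ?mulr0.
have hmem : (n %% p)%N \in index_iota 1 p by rewrite mem_index_iota lt0n h0 ltn_pmod ?prime_gt0.
rewrite (bigD1_seq _ hmem (iota_uniq _ _)) /= eqxx big1 ?addr0; last first.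
  by move=> i hi; rewrite eq_sym (negbTE hi) mulr0.
have hnp : ~~ (p%:Z %| r%:Z * (n %% p)%N%:Z)%Z.
  rewrite Euclid_dvdzM // negb_or hr /= -[(_ %| _)%Z]/(p %| n %% p)%N.
  by rewrite /dvdn modn_mod.
(* Only [i = n %% p] survives; the symbol is [1] or [-1] there, so half of it plus one is the
   indicator of a square. *)
congr (_ * _); rewrite /legendre (negbTE hnp) hq -/(sqmod p _).
by case: sqmod.
Qed.

(** The modulus divides [8] and odd squares are [1] modulo [8], so [r * n] is a square exactly when
    it is congruent to [r ^ 2]. *)
Lemma good_even (D : int) (r n : nat) : odd r ->
  good 2 D r%:Z n%:Z = (n %% 2 ^ (t2 D).+1 == r %% 2 ^ (t2 D).+1)%N.
Proof.
move=> ro; set q := (2 ^ (t2 D).+1)%N.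
have hro : ~~ (2%:Z %| r%:Z)%Z by rewrite -[(_ %| _)%Z]/(2 %| r)%N dvdn2 ro.
have q8 : (q%:Z %| 8)%Z.
  by rewrite /q /t2; case: ifP => // _; case: ifP.
have q0 : (0 < q)%N by rewrite expn_gt0.
have q2 : (2%:Z %| q%:Z)%Z by rewrite /q expnS PoszM dvdz_mulr.
have [k1 e1] := odd_sq hro.
have -> : (n %% q == r %% q)%N = (q%:Z %| n%:Z - r%:Z)%Z.
  by rewrite -eqz_mod_dvd !modz_nat.
rewrite /good /qmod /= -/q; apply/andP/idP => [[hn /(sqmodP _ q0) [y hy]]|h].
  have hy2 : ~~ (2%:Z %| y)%Z.
    apply/negP => h; have : (2%:Z %| r%:Z * n%:Z)%Z.
      rewrite -[_ * _](subKr (y ^+ 2)); apply: rpredB; first by rewrite expr2 dvdz_mulr.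
      exact: dvdz_trans q2 hy.
    by rewrite (Euclid_dvdzM _ _ (isT : prime 2)) (negbTE hro) (negbTE hn).
  have [k2 e2] := odd_sq hy2.
  rewrite (_ : _ - _ = 8 * (r%:Z * k2 - n%:Z * k1) - r%:Z * (y ^+ 2 - r%:Z * n%:Z)).
    by apply: rpredB; [apply: dvdz_mulr|apply: dvdz_mull].
  have -> : 8 * (r%:Z * k2 - n%:Z * k1) = r%:Z * (y ^+ 2 - 1) - n%:Z * (r%:Z ^+ 2 - 1).
    by rewrite e1 e2; ring.
  by ring.
split.
  by apply: contra hro => hn; rewrite -[r%:Z](subKr n%:Z); apply: rpredB => //; apply: dvdz_trans h.
apply/(sqmodP _ q0); exists r%:Z.
rewrite (_ : _ - _ = - r%:Z * (n%:Z - r%:Z)); last by ring.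
exact: dvdz_mull.
Qed.

(** * Assembly of the two identities *)

Theorem theorem6p1
  (a b c : int) (p : nat) (g0 : bqf) (R : seq bqf) (r : nat) :
  (* (a,b,c) primitive positive definite of discriminant Delta < 0 *)
  primitive (a, b, c) -> posdef (a, b, c) ->
  (* p prime *)
  prime p ->
  (* G = genus of g0, a genus of (positive definite, primitive) forms
     of discriminant Delta p^2 *)
  primitive g0 -> posdef g0 -> disc g0 = disc (a, b, c) * p%:Z ^+ 2 ->
  (* Psi_{G,p}(a,b,c) is nonempty *)
  (exists2 g, g \in psi_list p (a, b, c) &
     primitive g /\ same_genus (disc (a, b, c) * p%:Z ^+ 2) g0 g) ->
  (* R is a list of representatives of the classes of Psi_{G,p}(a,b,c),
     one for each class *)
  (forall g, g \in R -> [/\ g \in psi_list p (a, b, c), primitive g &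
     same_genus (disc (a, b, c) * p%:Z ^+ 2) g0 g]) ->
  (forall i j, (i < size R)%N -> (j < size R)%N ->
     sl2_equiv (nth g0 R i) (nth g0 R j) -> i = j) ->
  (forall g, g \in psi_list p (a, b, c) -> primitive g ->
     same_genus (disc (a, b, c) * p%:Z ^+ 2) g0 g ->
     exists2 h, h \in R & sl2_equiv g h) ->
  (* r positive, coprime to Delta p^2, represented by a form of Psi_{G,p} *)
  (0 < r)%N -> coprimez r%:Z (disc (a, b, c) * p%:Z ^+ 2) ->
  (exists g x y, g \in R /\ evalf g x y = r%:Z) ->
  let D := disc (a, b, c) in
  let w : rat := (wD D)%:R in
  (* identity of q-series, coefficient by coefficient *)
  (p != 2%N ->
    forall n : nat,
      w * (\sum_(g <- R) (rep g n)%:R) =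
      w * (size R)%:R * (theta_pow (a, b, c) (p ^ 2) n)%:R
      + \sum_(1 <= i < p)
          (((legendre (r%:Z * i%:Z) p)%:~R + 1) / 2) * (Pcoef p i (a, b, c) n)%:R)
  /\
  (p = 2%N ->
    forall n : nat,
      w * (\sum_(g <- R) (rep g n)%:R) =
      w * (size R)%:R * (theta_pow (a, b, c) 4 n)%:R
      + (Pcoef (2 ^ (t2 D).+1) (r %% 2 ^ (t2 D).+1) (a, b, c) n)%:R).
Proof.
move=> pf df pp _ _ _ _ hR hinj hS r0 hrcop [gr [xr [yr [hgr er]]]] D w.
set f := (a, b, c) in pf df hR hS hrcop D w *.
have hr : ~~ (p%:Z %| r%:Z)%Z.
  move: hrcop; rewrite coprimez_sym coprimezMl coprimez_pexpl // => /andP[_].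
  by rewrite coprimez_prime.
have p0 := prime_gt0 pp.
have [i0 egr] := mem_psi_list _ _ _ (let: And3 h _ _ := hR _ hgr in h).
have gr0 : good p D r%:Z r%:Z.
  by rewrite /good hr; apply/(sqmodP _ (qmod_gt0 pp D)); exists r%:Z; rewrite expr2 subrr dvdz0.
(* The form representing [r] fixes one lattice of the genus, whose square class is that of [r]. *)
have good0 : good p D r%:Z (qev f (pvec i0)).
  move: er; rewrite egr evalf_psi => er.
  have nz : ~~ pdiv2 p (latmap i0 (xr, yr)) by apply: (@qev_pdiv2 p f); rewrite er.
  by rewrite -(good_inlat pp f r%:Z (inlat_latmap i0 (xr, yr)) nz) er.
have [_ _ gen0] := hR _ hgr; rewrite egr in gen0.
have hR' g : g \in R -> exists2 j, g = psi f j & good p D r%:Z (qev f (@pvec p j)).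
  move=> /hR [/mem_psi_list [j ->] pj gj]; exists j => //.
  by apply: (good_same_genus pp pj good0); apply: same_genus_trans (same_genus_sym gen0) gj.
have hS' i : good p D r%:Z (qev f (@pvec p i)) -> exists2 h, h \in R & sl2_equiv (psi f i) h.
  move=> gi; apply: hS.
  - by apply/mem_psi_list; exists i.
  - by apply: primitive_psi => //; case/andP: gi.
  - by apply: same_genus_trans gen0 _; apply: (same_genus_psi pp df hr).
(* Two uses of [sum_classes]: with [rep] for the left side, and with the constant [1] to turn the
   number of good lattices into [wD D * size R]. *)
have main n : (wD D * \sum_(g <- R) rep g n =
    wD D * size R * theta_pow f (p ^ 2) n + good p D r%:Z n%:Z * rep f n)%N.
  rewrite -(@sum_classes p pp f df pf r%:Z g0 R (fun g => rep g n)) //; last first.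
    by move=> i j; apply: rep_sl2; apply: posdef_psi.
  rewrite sum_rep_psi //; congr (_ * _ + _)%N.
  rewrite -(sum1_size R) -(@sum_classes p pp f df pf r%:Z g0 R (fun=> 1%N)) //.
  by rewrite -sum1_card; apply: eq_bigl => i; rewrite inE.
have mainQ n : w * (\sum_(g <- R) (rep g n)%:R) =
    w * (size R)%:R * (theta_pow f (p ^ 2) n)%:R + (good p D r%:Z n%:Z)%:R * (rep f n)%:R.
  by rewrite -natr_sum -!natrM main natrD !natrM.
split=> [p2 n|p2 n]; rewrite ?mainQ; congr (_ + _).
  rewrite -(good_odd D n (rep f n)%:R pp p2 hr); apply: eq_bigr => i _.
  by congr (_ * _); rewrite /Pcoef; case: ifP.
- by rewrite p2.
rewrite p2 good_even /Pcoef; first by case: ifP; rewrite ?mul1r ?mul0r.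
by move: hr; rewrite p2 -[(_ %| _)%Z]/(2 %| r)%N dvdn2 negbK.
Qed.
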